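(* Assume that $a,b,c$ are generic. The two-sided ideal of $H_3(a,b,c)$ generated by $\mathbf{b}$ is the indecomposable ideal attached to the $3$-dimensional irreducible representation $V$. Moreover, the natural morphism $\mathcal{K}_n \to \mathcal{H}_n$ is an isomorphism for $n \leq 4$. In particular, with $\Sigma_1=a+b+c$, $\Sigma_2=ab+bc+ac$, $\Sigma_3=abc$, the following hold. Inside $\mathcal{K}_3$: (i) $(s_i-a)(s_i-b)(s_i-c)=0$ for $i\in\{1,2\}$; (ii) $s_2^2 s_1 = s_2 s_1^2 - s_1^2 s_2+s_1s_2^2$; (iii) $s_2 s_1^2s_2 = -\Sigma_3 s_1 + \Sigma_2 s_1s_2 + s_1 s_2 s_1^2 - \Sigma_1 s_1 s_2^2 + s_1^2s_2^2$. Inside $\mathcal{K}_4$: (iv) $s_2 s_3^2 = -s_1^2 s_3 + s_1^2s_2 + s_2^2s_3 - s_1 s_2^2 + s_1 s_3^2$; (v) $s_2^2s_3s_1 = s_2 s_1^2s_3 - s_1^2 s_2 s_3 + s_1 s_2^2 s_3$; (vi) $s_2^2s_3^2 = -\Sigma_3 s_1 + \Sigma_2 s_1s_3 - \Sigma_1 s_1^2s_3 + \Sigma_3 s_2 - \Sigma_2 s_2s_3 + \Sigma_1 s_1^2s_2 - s_1^2s_2s_3 + \Sigma_1 s_2^2 s_3 - \Sigma_1 s_1 s_2^2 + s_1 s_2^2 s_3 + s_1^2 s_3^2$; (vii) $s_2^2s_3^2 =-\Sigma_3 s_1 + \Sigma_2 s_1s_3 - \Sigma_1 s_1^2s_3 +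 \Sigma_3 s_2 - \Sigma_2 s_2s_3 + \Sigma_1 s_1^2s_2 + \Sigma_1 s_2^2 s_3 - \Sigma_1 s_1 s_2^2+s_1^2s_3^2 + s_2^2s_1 s_3 - s_2 s_1^2s_3$.
   Context: $K$ is a field of characteristic $0$, $a,b,c\in K$, $B_n$ is the braid group with Artin generators $s_1,\dots,s_{n-1}$ ($n\ge2$), and $H_n(a,b,c)=KB_n/((s_1-a)(s_1-b)(s_1-c))$. ''Generic'' means: $a,b,c$ and $(a-b)(a-c)(b-c)$ are nonzero and the algebras $H_3(a,b,c)$, $H_4(a,b,c)$ are split semisimple over $K$ (e.g. $a,b,c$ algebraically independent over $\mathbb{Q}$). $V$ is the (unique) $3$-dimensional irreducible representation of $H_3(a,b,c)$. $\mathbf{b}= s_2^2 s_1 - s_1 s_2^2 - s_2 s_1^2 + s_1^2 s_2$ and $\mathcal{K}_n=H_n(a,b,c)/(\mathbf{b})$ (quotient by the two-sided ideal generated by $\mathbf b$; for $n=2$, $\mathcal{K}_2=H_2(a,b,c)$). For $x\ne y$ in $\{a,b,c\}$ let $J_n(x,y)\subset KB_n$ be the two-sided ideal generated by $(s_1-x)(s_1-y)$; then $\mathcal{H}_n = KB_n/(J_n(a,b)\cap J_n(a,c)\cap J_n(b,c))$. The natural morphism $\mathcal{K}_n\to\mathcal{H}_n$ is the surjection $s_i\mapsto s_i$. *)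

(* Defs.v *)
From HB Require Import structures.
From mathcomp Require Import all_boot all_order all_algebra.
From mathcomp Require Import boolp classical_sets.
From mathcomp Require Import finmap monalg.

Set Implicit Arguments.
Unset Strict Implicit.
Unset Printing Implicit Defensive.

Import GRing.Theory.

Local Open Scope classical_set_scope.
Local Open Scope ring_scope.
Local Open Scope quotient_scope.

(* MathComp's algType excludes the zero ring, whereas a quotient by an
   arbitrary two-sided ideal may vanish. A K-algebra is therefore a possibly
   zero ring with a ring morphism from K to its centre, written a%:S. *)
HB.mixin Record isKAlgebra (K : pzRingType) A of GRing.PzRing A := {
  kscal : K -> A;
  kscalB : {morph kscal : a b / a - b};
  kscal1 : kscal 1 = 1;
  kscalM : {morph kscal : a b / a * b};
  kscalC : forall a x, kscal a * x = x * kscal a }.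

#[short(type="kalgType")]
HB.structure Definition KAlgebra (K : pzRingType) :=
  {A of GRing.PzRing A & isKAlgebra K A}.

Notation "a %:S" := (kscal a) (at level 2, left associativity, format "a %:S")
  : ring_scope.

Definition alg_morphism (K : pzRingType) (A B : kalgType K)
    (f : {rmorphism A -> B}) : Prop :=
  forall a : K, f a%:S = a%:S.

Section MatrixAlgebra.
Variables (K : comPzRingType) (n : nat).

Fact matrix_kscalB : {morph @scalar_mx K n : a b / a - b}.
Proof. by move=> a b; rewrite raddfB. Qed.

Fact matrix_kscal1 : 1%:M = 1 :> 'M[K]_n.
Proof. by []. Qed.

Fact matrix_kscalM : {morph @scalar_mx K n : a b / a * b}.
Proof. by move=> a b; rewrite scalar_mxM. Qed.

Fact matrix_kscalC (a : K) (x : 'M[K]_n) : a%:M * x = x * a%:M.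
Proof. by rewrite -[RHS]/(x *m a%:M) scalar_mxC. Qed.

HB.instance Definition _ := isKAlgebra.Build K 'M[K]_n
  matrix_kscalB matrix_kscal1 matrix_kscalM matrix_kscalC.
End MatrixAlgebra.

(* The operations below are locked so that unification does not unfold a
   product into the image of a representative. *)
Fact op_key : unit. Proof. exact: tt. Qed.

(* The letter (x, true) stands for x and (x, false) for its inverse. *)
Section PresentedGroup.
Variables (X : choiceType) (R : seq (X * bool) -> seq (X * bool) -> Prop).
Local Notation word := (seq (X * bool)).

Inductive pres_eq : word -> word -> Prop :=
| pres_refl w : pres_eq w w
| pres_sym w w' : pres_eq w w' -> pres_eq w' w
| pres_trans w w' w'' : pres_eq w w' -> pres_eq w' w'' -> pres_eq w w''
| pres_cancel u v x e : pres_eq (u ++ [:: (x, e); (x, ~~ e)] ++ v) (u ++ v)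
| pres_rel u v w w' : R w w' -> pres_eq (u ++ w ++ v) (u ++ w' ++ v).

Definition pres_eqb (w w' : word) : bool := `[< pres_eq w w' >].

Fact pres_eqb_refl : reflexive pres_eqb.
Proof. by move=> w; apply/asboolP; exact: pres_refl. Qed.

Fact pres_eqb_sym : symmetric pres_eqb.
Proof. by move=> u v; apply/asboolP/asboolP; exact: pres_sym. Qed.

Fact pres_eqb_trans : transitive pres_eqb.
Proof.
by move=> v u w /asboolP uv /asboolP vw; apply/asboolP; exact: pres_trans vw.
Qed.

Canonical pres_equiv := EquivRel pres_eqb pres_eqb_refl pres_eqb_sym
  pres_eqb_trans.

Definition presented := {eq_quot pres_equiv}.

HB.instance Definition _ := Choice.on presented.
HB.instance Definition _ := EqQuotient.on presented.

Definition pres_class (w : word) : presented := \pi_presented w.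

Lemma pres_class_surj (g : presented) : exists w, g = pres_class w.
Proof. by exists (repr g); rewrite /pres_class reprK. Qed.

Lemma presentedP (w w' : word) :
  pres_class w = pres_class w' <-> pres_eq w w'.
Proof.
by split=> [/eqquotP /asboolP|ww']; last by apply/eqquotP/asboolP.
Qed.

Lemma pres_eq_ctx u v w w' :
  pres_eq w w' -> pres_eq (u ++ w ++ v) (u ++ w' ++ v).
Proof.
elim=> {w w'} [w|w w' _ IH|w w' w'' _ IH _ IH'|a b x e|a b w w' r].
- exact: pres_refl.
- exact: pres_sym.
- exact: pres_trans IH'.
- by have := pres_cancel (u ++ a) (b ++ v) x e; rewrite /= -!catA.
- by have := pres_rel (u ++ a) (b ++ v) r; rewrite /= -!catA.
Qed.

Lemma pres_eq_cat u u' v v' :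
  pres_eq u u' -> pres_eq v v' -> pres_eq (u ++ v) (u' ++ v').
Proof.
move=> uu' vv'; apply: pres_trans (pres_eq_ctx [::] v uu') _.
by have := pres_eq_ctx u' [::] vv'; rewrite !cats0.
Qed.

Definition word_inv (w : word) : word := rev [seq (l.1, ~~ l.2) | l <- w].

Lemma word_inv_cat u v : word_inv (u ++ v) = word_inv v ++ word_inv u.
Proof. by rewrite /word_inv map_cat rev_cat. Qed.

Lemma word_invK : involutive word_inv.
Proof.
move=> w; rewrite /word_inv map_rev revK -map_comp.
by rewrite -[RHS]map_id; apply: eq_map => -[x e] /=; rewrite negbK.
Qed.

Lemma pres_mulwV w : pres_eq (w ++ word_inv w) [::].
Proof.
elim: w => [|[x e] w IH]; first exact: pres_refl.
rewrite -cat1s word_inv_cat -catA (catA w).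
apply: pres_trans (pres_eq_ctx _ _ IH) _.
exact: (pres_cancel [::] [::] x e).
Qed.

Lemma pres_mulVw w : pres_eq (word_inv w ++ w) [::].
Proof. by rewrite -{2}(word_invK w); exact: pres_mulwV. Qed.

Lemma pres_eq_inv u v : pres_eq u v -> pres_eq (word_inv u) (word_inv v).
Proof.
move=> uv; have H1 := pres_eq_ctx (word_inv u) (word_inv v) (pres_sym uv).
have := pres_eq_cat (pres_mulVw u) (pres_refl (word_inv v)).
rewrite -catA /= => H2; have := pres_trans H1 H2 => H3.
have := pres_eq_cat (pres_refl (word_inv u)) (pres_mulwV v).
by rewrite cats0 => H4; apply: pres_trans (pres_sym H4) H3.
Qed.

Definition pres_one : presented := pres_class [::].
Definition pres_mul : presented -> presented -> presented :=
  locked_with op_key (fun g h => pres_class (repr g ++ repr h)).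
Definition pres_inv : presented -> presented :=
  locked_with op_key (fun g => pres_class (word_inv (repr g))).

Lemma pres_eq_repr w : pres_eq (repr (pres_class w)) w.
Proof. by apply/presentedP; rewrite /pres_class reprK. Qed.

Lemma pres_mulE u v :
  pres_mul (pres_class u) (pres_class v) = pres_class (u ++ v).
Proof.
rewrite /pres_mul locked_withE.
by apply/presentedP/pres_eq_cat; exact: pres_eq_repr.
Qed.

Lemma pres_invE u : pres_inv (pres_class u) = pres_class (word_inv u).
Proof.
rewrite /pres_inv locked_withE.
by apply/presentedP/pres_eq_inv; exact: pres_eq_repr.
Qed.

Fact pres_mulA : associative pres_mul.
Proof.
move=> g h k; have [u ->] := pres_class_surj g.
have [v ->] := pres_class_surj h.
by have [w ->] := pres_class_surj k; rewrite !pres_mulE catA.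
Qed.

Fact pres_mul1 : left_id pres_one pres_mul.
Proof. by move=> g; have [w ->] := pres_class_surj g; rewrite pres_mulE. Qed.

Fact pres_mulr1 : right_id pres_one pres_mul.
Proof.
by move=> g; have [w ->] := pres_class_surj g; rewrite pres_mulE cats0.
Qed.

Fact pres_mulV : left_inverse pres_one pres_inv pres_mul.
Proof.
move=> g; have [w ->] := pres_class_surj g; rewrite pres_invE pres_mulE.
by apply/presentedP; exact: pres_mulVw.
Qed.

Fact pres_mulrV : right_inverse pres_one pres_inv pres_mul.
Proof.
move=> g; have [w ->] := pres_class_surj g; rewrite pres_invE pres_mulE.
by apply/presentedP; exact: pres_mulwV.
Qed.

HB.instance Definition _ := isGroup.Build presented
  pres_mulA pres_mul1 pres_mulr1 pres_mulV pres_mulrV.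

End PresentedGroup.

(* Generators are indexed as s_1, ..., s_{n-1}. *)
Definition braid_index (n : nat) := {i : nat | (0 < i < n)%N}.

Inductive braid_rel (n : nat) :
  seq (braid_index n * bool) -> seq (braid_index n * bool) -> Prop :=
| braid_far (i j : braid_index n) : ((val i).+1 < val j)%N ->
    braid_rel [:: (i, true); (j, true)] [:: (j, true); (i, true)]
| braid_adj (i j : braid_index n) : val j = (val i).+1 ->
    braid_rel [:: (i, true); (j, true); (i, true)]
              [:: (j, true); (i, true); (j, true)].

Definition braid (n : nat) := presented (@braid_rel n).
HB.instance Definition _ (n : nat) := Group.on (braid n).

(* The Artin generator s_i if 0 < i < n, the neutral element otherwise. *)
Definition artin (n i : nat) : braid n :=
  if insub i is Some x then pres_class (@braid_rel n) [:: (x, true)] else 1%g.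

Definition group_algebra (K : nzRingType) (G : groupType) := {malg K[G]}.

Section GroupAlgebra.
Variables (K : comNzRingType) (G : groupType).
Local Notation KG := (group_algebra K G).
Local Open Scope fset_scope.
Local Open Scope ring_scope.

HB.instance Definition _ := GRing.Lmodule.on KG.

Implicit Types (f g h : {malg K[G]}).

Definition ga_one : {malg K[G]} := << 1%g >>.

Definition ga_mul : {malg K[G]} -> {malg K[G]} -> {malg K[G]} :=
  locked_with op_key (fun f g =>
    \sum_(x <- msupp f) \sum_(y <- msupp g) << f@_x * g@_y *g (x * y)%g >>).

Lemma ga_mulEw (d1 d2 : {fset G}) f g :
  msupp f `<=` d1 -> msupp g `<=` d2 ->
  ga_mul f g = \sum_(x <- d1) \sum_(y <- d2) << f@_x * g@_y *g (x * y)%g >>.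
Proof.
move=> le1 le2; rewrite /ga_mul locked_withE (big_fset_incl _ le1) /=.
  apply/eq_bigr=> x _; apply/big_fset_incl => // y _ /mcoeff_outdom ->.
  by rewrite mulr0 monalgU0.
move=> x _ /mcoeff_outdom fx.
by rewrite big1 => // y _; rewrite fx mul0r monalgU0.
Qed.

Fact ga_mulDl : left_distributive ga_mul +%R.
Proof.
move=> f g h; pose d := msupp f `|` msupp g.
rewrite (@ga_mulEw d (msupp h)) ?msuppD_le ?fsubset_refl //.
rewrite (@ga_mulEw d (msupp h) f) ?fsubsetUl ?fsubset_refl //.
rewrite (@ga_mulEw d (msupp h) g) ?fsubsetUr ?fsubset_refl //.
rewrite -big_split /=; apply/eq_bigr=> x _.
rewrite -big_split /=; apply/eq_bigr=> y _.
by rewrite mcoeffD mulrDl monalgUD.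
Qed.

Fact ga_mulDr : right_distributive ga_mul +%R.
Proof.
move=> h f g; pose d := msupp f `|` msupp g.
rewrite (@ga_mulEw (msupp h) d) ?msuppD_le ?fsubset_refl //.
rewrite (@ga_mulEw (msupp h) d h f) ?fsubsetUl ?fsubset_refl //.
rewrite (@ga_mulEw (msupp h) d h g) ?fsubsetUr ?fsubset_refl //.
rewrite -big_split /=; apply/eq_bigr=> x _.
rewrite -big_split /=; apply/eq_bigr=> y _.
by rewrite mcoeffD mulrDr monalgUD.
Qed.

Lemma ga_mul0r f : ga_mul 0 f = 0.
Proof. by rewrite /ga_mul locked_withE msupp0 big_seq_fset0. Qed.

Lemma ga_mulr0 f : ga_mul f 0 = 0.
Proof. by rewrite /ga_mul locked_withE exchange_big msupp0 big_seq_fset0. Qed.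

Lemma ga_mulUU (a b : K) (x y : G) :
  ga_mul << a *g x >> << b *g y >> = << a * b *g (x * y)%g >>.
Proof. by rewrite (ga_mulEw msuppU_le msuppU_le) !big_seq_fset1 !mcoeffUU. Qed.

Lemma ga_ind (P : {malg K[G]} -> Prop) :
  P 0 -> (forall f g, P f -> P g -> P (f + g)) ->
  (forall a x, P << a *g x >>) -> forall f, P f.
Proof.
by move=> P0 PD PU f; rewrite [f]monalgE; elim/big_ind: _ => // x _; apply: PU.
Qed.

Fact ga_mul1 : left_id ga_one ga_mul.
Proof.
elim/ga_ind=> [|f g IHf IHg|a x]; first by rewrite ga_mulr0.
  by rewrite ga_mulDr IHf IHg.
by rewrite ga_mulUU mul1r mul1g.
Qed.

Fact ga_mulr1 : right_id ga_one ga_mul.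
Proof.
elim/ga_ind=> [|f g IHf IHg|a x]; first by rewrite ga_mul0r.
  by rewrite ga_mulDl IHf IHg.
by rewrite ga_mulUU mulr1 mulg1.
Qed.

Fact ga_mulA : associative ga_mul.
Proof.
move=> f g h; elim/ga_ind: f => [|f f' IH IH'|a x]; first by rewrite !ga_mul0r.
  by rewrite !ga_mulDl IH IH'.
elim/ga_ind: g => [|g g' IH IH'|b y]; first by rewrite !(ga_mul0r, ga_mulr0).
  by rewrite !(ga_mulDr, ga_mulDl) IH IH'.
elim/ga_ind: h => [|h h' IH IH'|c z]; first by rewrite !ga_mulr0.
  by rewrite !ga_mulDr IH IH'.
by rewrite !ga_mulUU mulrA mulgA.
Qed.

HB.instance Definition _ := GRing.Zmodule_isPzRing.Build KG
  ga_mulA ga_mul1 ga_mulr1 ga_mulDl ga_mulDr.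

Definition ga_scal (a : K) : KG := << a *g 1%g >>.

Fact ga_scalB : {morph ga_scal : a b / a - b}.
Proof. by move=> a b; exact: monalgUB. Qed.

Fact ga_scal1 : ga_scal 1 = 1.
Proof. by []. Qed.

Fact ga_scalM : {morph ga_scal : a b / a * b}.
Proof. by move=> a b; rewrite /ga_scal [RHS]ga_mulUU mulg1. Qed.

Fact ga_scalC (a : K) (x : KG) : ga_scal a * x = x * ga_scal a.
Proof.
change (ga_mul << a *g 1%g >> x = ga_mul x << a *g 1%g >>).
elim/ga_ind: x => [|f g IHf IHg|b y]; first by rewrite ga_mul0r ga_mulr0.
  by rewrite ga_mulDl ga_mulDr IHf IHg.
by rewrite !ga_mulUU mulg1 mul1g mulrC.
Qed.

HB.instance Definition _ := isKAlgebra.Build K KG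
  ga_scalB ga_scal1 ga_scalM ga_scalC.

Definition ga_of (x : G) : KG := << x >>.

End GroupAlgebra.

Definition two_sided (A : pzRingType) (I : set A) : Prop :=
  [/\ I 0, forall x y, I x -> I y -> I (x + y)
    & forall x y z, I y -> I (x * y * z)].

Record ideal (A : pzRingType) := Ideal {
  ideal_set :> set A;
  idealP : two_sided ideal_set }.

Definition ideal_mem (A : pzRingType) (I : ideal A) (x : A) : Prop :=
  ideal_set I x.
Coercion ideal_mem : ideal >-> Funclass.

Section Ideals.
Variable A : pzRingType.

Fact gen_ideal_two_sided (S : set A) : two_sided (smallest (@two_sided A) S).
Proof.
split=> [I [[]] //|x y Ix Iy I SI|x y z Iy I SI].
  by have [[_ + _] _] := SI; apply; [exact: Ix|exact: Iy].
by have [[_ _ +] _] := SI; apply; exact: Iy.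
Qed.

Definition gen_ideal (S : set A) : ideal A := Ideal (gen_ideal_two_sided S).

Fact cap_ideal_two_sided (I J : ideal A) : two_sided (I `&` J).
Proof.
have [[I0 ID IM] [J0 JD JM]] := (idealP I, idealP J).
split=> [//|x y [Ix Jx] [Iy Jy]|x y z [Iy Jy]].
  by split; [exact: ID|exact: JD].
by split; [exact: IM|exact: JM].
Qed.

Definition cap_ideal (I J : ideal A) : ideal A :=
  Ideal (cap_ideal_two_sided I J).

Definition zero_set (I : set A) : Prop := forall x, I x -> x = 0.

Definition direct_sum (I J J' : set A) : Prop :=
  (forall x, I x <-> exists y z, [/\ J y, J' z & x = y + z]) /\
  zero_set (J `&` J').

Definition indecomposable (I : ideal A) : Prop :=
  ~ zero_set I /\
  forall J J' : ideal A, direct_sum I J J' -> zero_set J \/ zero_set J'.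

End Ideals.

Section QuotientAlgebra.
Variables (K : pzRingType) (A : kalgType K) (I : ideal A).

Definition ideal_eqb (x y : A) : bool := `[< I (x - y) >].

Lemma idealN x : I x -> I (- x).
Proof.
have [_ _ IM] := idealP I => Ix.
by rewrite -mulN1r -[X in I X]mulr1; exact: IM.
Qed.

Fact ideal_eqb_refl : reflexive ideal_eqb.
Proof. by move=> x; apply/asboolP; rewrite subrr; case: (idealP I). Qed.

Fact ideal_eqb_sym : symmetric ideal_eqb.
Proof.
by move=> x y; apply/asboolP/asboolP => /idealN; rewrite opprB.
Qed.

Fact ideal_eqb_trans : transitive ideal_eqb.
Proof.
move=> y x z /asboolP xy /asboolP yz; apply/asboolP.
by have [_ ID _] := idealP I; have := ID _ _ xy yz; rewrite addrA subrK.
Qed.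

Canonical ideal_equiv := EquivRel ideal_eqb ideal_eqb_refl ideal_eqb_sym
  ideal_eqb_trans.

Definition quo := {eq_quot ideal_equiv}.

HB.instance Definition _ := Choice.on quo.
HB.instance Definition _ := EqQuotient.on quo.

Definition quo_proj (x : A) : quo := \pi_quo x.

Lemma quo_proj_surj (u : quo) : exists x, u = quo_proj x.
Proof. by exists (repr u); rewrite /quo_proj reprK. Qed.

Lemma quoP (x y : A) : quo_proj x = quo_proj y <-> I (x - y).
Proof. by split=> [/eqquotP /asboolP|xy]; last by apply/eqquotP/asboolP. Qed.

Definition quo_add : quo -> quo -> quo :=
  locked_with op_key (fun u v => quo_proj (repr u + repr v)).
Definition quo_opp : quo -> quo :=
  locked_with op_key (fun u => quo_proj (- repr u)).
Definition quo_mul : quo -> quo -> quo :=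
  locked_with op_key (fun u v => quo_proj (repr u * repr v)).

Lemma quo_repr x : I (repr (quo_proj x) - x).
Proof. by apply/quoP; rewrite /quo_proj reprK. Qed.

Lemma quo_addE x y : quo_add (quo_proj x) (quo_proj y) = quo_proj (x + y).
Proof.
rewrite /quo_add locked_withE; apply/quoP; have [_ ID _] := idealP I.
by rewrite opprD addrACA; apply: ID; exact: quo_repr.
Qed.

Lemma quo_oppE x : quo_opp (quo_proj x) = quo_proj (- x).
Proof.
rewrite /quo_opp locked_withE; apply/quoP; rewrite -opprD; apply: idealN.
exact: quo_repr.
Qed.

Lemma quo_mulE x y : quo_mul (quo_proj x) (quo_proj y) = quo_proj (x * y).
Proof.
rewrite /quo_mul locked_withE; apply/quoP; have [_ ID IM] := idealP I.
set x' := repr _; set y' := repr _.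
rewrite -(subrKA (x * y')) -mulrBl -mulrBr; apply: ID.
  by rewrite -[_ * y']mul1r mulrA; apply: IM; exact: quo_repr.
by rewrite -[x * _]mulr1; apply: IM; exact: quo_repr.
Qed.

Definition quoE := (quo_addE, quo_oppE, quo_mulE).

Fact quo_addA : associative quo_add.
Proof.
move=> u v w; have [x ->] := quo_proj_surj u.
have [y ->] := quo_proj_surj v; have [z ->] := quo_proj_surj w.
by rewrite !quoE addrA.
Qed.

Fact quo_addC : commutative quo_add.
Proof.
move=> u v; have [x ->] := quo_proj_surj u.
by have [y ->] := quo_proj_surj v; rewrite !quoE addrC.
Qed.

Fact quo_add0 : left_id (quo_proj 0) quo_add.
Proof. by move=> u; have [x ->] := quo_proj_surj u; rewrite !quoE add0r. Qed.

Fact quo_addN : left_inverse (quo_proj 0) quo_opp quo_add.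
Proof. by move=> u; have [x ->] := quo_proj_surj u; rewrite !quoE addNr. Qed.

Fact quo_mulA : associative quo_mul.
Proof.
move=> u v w; have [x ->] := quo_proj_surj u.
have [y ->] := quo_proj_surj v; have [z ->] := quo_proj_surj w.
by rewrite !quoE mulrA.
Qed.

Fact quo_mul1 : left_id (quo_proj 1) quo_mul.
Proof. by move=> u; have [x ->] := quo_proj_surj u; rewrite !quoE mul1r. Qed.

Fact quo_mulr1 : right_id (quo_proj 1) quo_mul.
Proof. by move=> u; have [x ->] := quo_proj_surj u; rewrite !quoE mulr1. Qed.

Fact quo_mulDl : left_distributive quo_mul quo_add.
Proof.
move=> u v w; have [x ->] := quo_proj_surj u.
have [y ->] := quo_proj_surj v; have [z ->] := quo_proj_surj w.
by rewrite !quoE mulrDl.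
Qed.

Fact quo_mulDr : right_distributive quo_mul quo_add.
Proof.
move=> u v w; have [x ->] := quo_proj_surj u.
have [y ->] := quo_proj_surj v; have [z ->] := quo_proj_surj w.
by rewrite !quoE mulrDr.
Qed.

HB.instance Definition _ := GRing.isPzRing.Build quo
  quo_addA quo_addC quo_add0 quo_addN quo_mulA quo_mul1 quo_mulr1
  quo_mulDl quo_mulDr.

Definition quo_scal (a : K) : quo := quo_proj a%:S.

Fact quo_scalB : {morph quo_scal : a b / a - b}.
Proof.
move=> a b; rewrite /quo_scal kscalB.
by change (quo_proj (a%:S - b%:S) =
           quo_add (quo_proj a%:S) (quo_opp (quo_proj b%:S)));
  rewrite !quoE.
Qed.

Fact quo_scal1 : quo_scal 1 = 1.
Proof. by rewrite /quo_scal kscal1. Qed.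

Fact quo_scalM : {morph quo_scal : a b / a * b}.
Proof.
move=> a b; rewrite /quo_scal kscalM.
change (quo_proj (a%:S * b%:S) = quo_mul (quo_proj a%:S) (quo_proj b%:S)).
by rewrite !quoE.
Qed.

Fact quo_scalC (a : K) (u : quo) : quo_scal a * u = u * quo_scal a.
Proof.
rewrite /quo_scal; have [x ->] := quo_proj_surj u.
change (quo_mul (quo_proj a%:S) (quo_proj x) =
        quo_mul (quo_proj x) (quo_proj a%:S)).
by rewrite !quoE kscalC.
Qed.

HB.instance Definition _ := isKAlgebra.Build K quo
  quo_scalB quo_scal1 quo_scalM quo_scalC.

Fact quo_proj_zmod : zmod_morphism quo_proj.
Proof.
move=> x y.
by change (quo_proj (x - y) = quo_add (quo_proj x) (quo_opp (quo_proj y)));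
  rewrite !quoE.
Qed.

Fact quo_proj_monoid : monoid_morphism quo_proj.
Proof.
split=> // x y; rewrite /quo_proj.
by change (quo_proj (x * y) = quo_mul (quo_proj x) (quo_proj y));
  rewrite !quoE.
Qed.

HB.instance Definition _ := GRing.isZmodMorphism.Build A quo quo_proj
  quo_proj_zmod.
HB.instance Definition _ := GRing.isMonoidMorphism.Build A quo quo_proj
  quo_proj_monoid.

End QuotientAlgebra.

(* A is isomorphic to a finite product of matrix algebras over K, the f i
   being the components of the isomorphism. *)
Definition split_semisimple (K : fieldType) (A : kalgType K) : Prop :=
  exists (r : nat) (d : 'I_r -> nat)
         (f : forall i, {rmorphism A -> 'M[K]_((d i).+1)}),
    (forall i, alg_morphism (f i)) /\
    (forall y : forall i, 'M[K]_((d i).+1),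
       exists! x : A, forall i, f i x = y i).

(* Matrices act on row vectors, as in mxrepresentation. The annihilators of
   the stable subspaces of rows are the stable subspaces of columns, so this is
   also irreducibility of the action on column vectors. *)
Definition irreducible_rep (K : fieldType) (A : kalgType K) (d : nat)
    (rho : {rmorphism A -> 'M[K]_d}) : Prop :=
  [/\ (0 < d)%N, alg_morphism rho
    & forall U : 'M[K]_d, (forall x, stablemx U (rho x)) ->
        U = 0 \/ row_full U].

(* The indecomposable direct factor of A to which rho belongs: an irreducible
   representation is nonzero on exactly one indecomposable factor. *)
Definition attached_ideal (K : fieldType) (A : kalgType K) (I : ideal A)
    (d : nat) (rho : {rmorphism A -> 'M[K]_d}) : Prop :=
  [/\ indecomposable I,
      exists J : ideal A, direct_sum setT I J
    & exists2 x, I x & rho x <> 0].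

Section CubicHecke.
Variables (K : fieldType) (n : nat).

Definition KB : kalgType K := group_algebra K (braid n).
Definition sB (i : nat) : KB := ga_of K (artin n i).

Definition cubic_ideal (a b c : K) : ideal KB :=
  gen_ideal [set (sB 1 - a%:S) * (sB 1 - b%:S) * (sB 1 - c%:S)].

Variables (a b c : K).

Definition Hn : kalgType K := quo (cubic_ideal a b c).
Definition sH (i : nat) : Hn := quo_proj (cubic_ideal a b c) (sB i).

Definition bH : Hn :=
  sH 2 ^+ 2 * sH 1 - sH 1 * sH 2 ^+ 2 - sH 2 * sH 1 ^+ 2 + sH 1 ^+ 2 * sH 2.

(* For n = 2 there is no generator s_2 and the ideal is zero. *)
Definition b_ideal : ideal Hn := gen_ideal [set x | (2 < n)%N /\ x = bH].

Definition calK : kalgType K := quo b_ideal.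
Definition sK (i : nat) : calK := quo_proj b_ideal (sH i).

Definition Jn (x y : K) : ideal KB :=
  gen_ideal [set (sB 1 - x%:S) * (sB 1 - y%:S)].

Definition Jcap : ideal KB := cap_ideal (cap_ideal (Jn a b) (Jn a c)) (Jn b c).

Definition calH : kalgType K := quo Jcap.
Definition sHH (i : nat) : calH := quo_proj Jcap (sB i).

End CubicHecke.

Definition generic (K : fieldType) (a b c : K) : Prop :=
  [/\ [/\ a != 0, b != 0 & c != 0], (a - b) * (a - c) * (b - c) != 0,
      split_semisimple (Hn 3 a b c) & split_semisimple (Hn 4 a b c)].

(* Main.v *)
(** A module over the cubic Hecke algebra splits into the eigenspaces of each
    generator; let e_x(i) be the projection onto the x-eigenspace of s_i. The
    relation b = 0 says that e_x(i) e_y(j) e_z(i) = 0 for distinct eigenvalues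
    x, y, z and adjacent i, j. Together with the braid relation it forces
    e_x(i) e_y(j) e_z(k) = 0 for all i, j, k < n when n <= 4, hence
    e_x(i) e_y(j) X e_z(k) = 0 for every word X in the generators, by induction
    on its length. In a matrix factor of the semisimple algebra H_n, one of the
    three eigenprojections of s_1 must then vanish, i.e. the factor satisfies a
    quadratic relation. So K_n and the quotient by the intersection of the
    J_n(x, y) have the same factors, and identities in K_n can be checked in
    the three quadratic Hecke algebras.

    For n = 3, the factors of H_3 on which b does not vanish have size at least
    3 since all three eigenprojections are nonzero there, whereas the ideal of b
    is spanned by nine words; hence there is exactly one such factor. An
    irreducible representation of dimension 3 belongs to it: otherwise s_1 and
    s_2 would satisfy a common quadratic relation and, being conjugate, would
    share an eigenvector. *)

Require Import Defs.
From HB Require Import structures.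
From mathcomp Require Import all_boot all_order all_algebra.
From mathcomp Require Import boolp classical_sets.
From mathcomp Require Import finmap monalg zify ring.

Set Implicit Arguments.
Unset Strict Implicit.
Unset Printing Implicit Defensive.

Import GRing.Theory.

Local Open Scope ring_scope.

(** * Noncommutative identities *)

Section ScalarTheory.
Variables (K : pzRingType) (A : kalgType K).
Implicit Types (x y k : K) (u v : A).

Lemma kscal0 : 0%:S = 0 :> A.
Proof. by rewrite -(subrr (0 : K)) kscalB subrr. Qed.

Lemma kscalN x : (- x)%:S = - x%:S :> A.
Proof. by rewrite -sub0r kscalB kscal0 sub0r. Qed.

Lemma kscalD x y : (x + y)%:S = x%:S + y%:S :> A.
Proof. by rewrite -[y]opprK kscalB [in LHS]kscalN !opprK. Qed.

Lemma kscalX x n : (x ^+ n)%:S = x%:S ^+ n :> A.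
Proof. by elim: n => [|n IH]; rewrite ?kscal1 // !exprS kscalM IH. Qed.

Definition kscalE := (kscalN, @kscalB K A, kscalD, @kscalM K A, kscalX, kscal0,
  @kscal1 K A).

Lemma kscalCA x u v : u * (x%:S * v) = x%:S * (u * v).
Proof. by rewrite mulrA -kscalC mulrA. Qed.

Lemma kscalMK x y u : x * y = 1 -> x%:S * (y%:S * u) = u.
Proof. by move=> xy; rewrite mulrA -kscalM xy kscal1 mul1r. Qed.

End ScalarTheory.

Lemma kscal_regular (K : fieldType) (A : kalgType K) (k : K) (u : A) :
  k != 0 -> k%:S * u = 0 -> u = 0.
Proof. by move=> k0 ku; rewrite -[u](kscalMK _ (mulVf k0)) ku mulr0. Qed.

Section NoncommutativeNormalForm.

Inductive nexp :=
| NScal of nat | NVar of nat | NZero | NOne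
| NAdd of nexp & nexp | NMul of nexp & nexp | NOpp of nexp | NExp of nexp & nat.

(** Scalars are central, so in normal forms their indices are kept as a sorted list; the second list
    is a word in the noncommuting variables. *)
Definition nmon := (seq nat * seq nat)%type.
Definition npoly := seq (int * nmon).

Fixpoint npoly_ins (k : int) (m : nmon) (p : npoly) : npoly :=
  if p is (k', m') :: q then
    if m == m' then (k + k', m') :: q else (k', m') :: npoly_ins k m q
  else [:: (k, m)].

Definition npoly_add (p q : npoly) := foldr (fun t => npoly_ins t.1 t.2) q p.
Definition npoly_mul1 (k : int) (m : nmon) (q : npoly) : npoly :=
  [seq (k * t.1, (sort leq (m.1 ++ t.2.1), m.2 ++ t.2.2)) | t <- q].
Definition npoly_mul (p q : npoly) :=
  foldr (fun t => npoly_add (npoly_mul1 t.1 t.2 q)) [::] p.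

Fixpoint nnorm (t : nexp) : npoly :=
  match t with
  | NScal i => [:: (1, ([:: i], [::]))]
  | NVar i => [:: (1, ([::], [:: i]))]
  | NZero => [::]
  | NOne => [:: (1, ([::], [::]))]
  | NAdd t1 t2 => npoly_add (nnorm t1) (nnorm t2)
  | NMul t1 t2 => npoly_mul (nnorm t1) (nnorm t2)
  | NOpp t1 => npoly_mul1 (- 1) ([::], [::]) (nnorm t1)
  | NExp t1 n => iter n (npoly_mul (nnorm t1)) [:: (1, ([::], [::]))]
  end.

Variables (K : pzRingType) (A : kalgType K) (c : seq K) (x : seq A).

Fixpoint neval (t : nexp) : A :=
  match t with
  | NScal i => (c`_i)%:S
  | NVar i => x`_i
  | NZero => 0
  | NOne => 1
  | NAdd t1 t2 => neval t1 + neval t2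
  | NMul t1 t2 => neval t1 * neval t2
  | NOpp t1 => - neval t1
  | NExp t1 n => neval t1 ^+ n
  end.

Definition scal_eval (s : seq nat) : A := \prod_(i <- s) (c`_i)%:S.
Definition word_eval (s : seq nat) : A := \prod_(i <- s) x`_i.
Definition mon_eval (m : nmon) : A := scal_eval m.1 * word_eval m.2.
Definition npoly_eval (p : npoly) : A := \sum_(t <- p) mon_eval t.2 *~ t.1.

Lemma scal_eval_comm s u : scal_eval s * u = u * scal_eval s.
Proof.
rewrite /scal_eval; elim: s => [|i s IH]; first by rewrite big_nil mul1r mulr1.
by rewrite big_cons -mulrA IH mulrA kscalC mulrA.
Qed.

(** The images of scalars are central in [A], so the order of the factors is immaterial even over a
    noncommutative [K]. *)
Lemma scal_eval_perm s s' : perm_eq s s' -> scal_eval s = scal_eval s'.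
Proof.
elim: s s' => [|i s IH] s' ss'.
  by move: ss'; rewrite perm_sym => /perm_nilP ->.
have /path.splitPr s'i : i \in s' by rewrite -(perm_mem ss') mem_head.
case: s'i ss' => s1 s2 ss'.
have {}ss' : perm_eq s (s1 ++ s2).
  by move: ss'; rewrite perm_sym -cat1s perm_catCA /= perm_cons perm_sym.
rewrite /scal_eval big_cons -/(scal_eval s) (IH _ ss') /scal_eval !big_cat /=.
by rewrite big_cons mulrA kscalC -mulrA.
Qed.

Lemma mon_evalM m m' :
  mon_eval (sort leq (m.1 ++ m'.1), m.2 ++ m'.2) = mon_eval m * mon_eval m'.
Proof.
rewrite /mon_eval /= (@scal_eval_perm _ (m.1 ++ m'.1)) ?perm_sort //.
rewrite /scal_eval /word_eval !big_cat /= -!/(scal_eval _) -!/(word_eval _).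
by rewrite -!mulrA; congr (_ * _); rewrite !mulrA scal_eval_comm.
Qed.

Lemma npoly_eval_ins k m p :
  npoly_eval (npoly_ins k m p) = mon_eval m *~ k + npoly_eval p.
Proof.
rewrite /npoly_eval; elim: p => [|[k' m'] p IH] /=.
  by rewrite big_cons.
case: eqP => [->|_]; first by rewrite !big_cons /= mulrzDr addrA.
by rewrite !big_cons IH addrCA.
Qed.

Lemma npoly_evalD p q :
  npoly_eval (npoly_add p q) = npoly_eval p + npoly_eval q.
Proof.
elim: p => [|[k m] p IH] /=; first by rewrite {2}/npoly_eval big_nil add0r.
by rewrite npoly_eval_ins IH /npoly_eval big_cons addrA.
Qed.

Lemma npoly_evalM1 k m q :
  npoly_eval (npoly_mul1 k m q) = (mon_eval m *~ k) * npoly_eval q.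
Proof.
rewrite /npoly_eval /npoly_mul1 big_map mulr_sumr; apply: eq_bigr => t _ /=.
by rewrite mon_evalM mulrzAl mulrzAr -mulrzA mulrC.
Qed.

Lemma npoly_evalM p q :
  npoly_eval (npoly_mul p q) = npoly_eval p * npoly_eval q.
Proof.
elim: p => [|[k m] p IH] /=; first by rewrite /npoly_eval big_nil mul0r.
by rewrite npoly_evalD npoly_evalM1 IH [npoly_eval (_ :: _)]/npoly_eval
  big_cons mulrDl.
Qed.

Lemma mon_eval1 : mon_eval ([::], [::]) = 1.
Proof. by rewrite /mon_eval /scal_eval /word_eval !big_nil mulr1. Qed.

Lemma nnormE t : npoly_eval (nnorm t) = neval t.
Proof.
have ev1 m : npoly_eval [:: (1, m)] = mon_eval m.
  by rewrite /npoly_eval big_seq1.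
elim: t => [i|i|||t1 IH1 t2 IH2|t1 IH1 t2 IH2|t1 IH1|t1 IH1 n] /=.
- by rewrite ev1 /mon_eval /scal_eval /word_eval big_seq1 big_nil mulr1.
- by rewrite ev1 /mon_eval /scal_eval /word_eval big_seq1 big_nil mul1r.
- by rewrite /npoly_eval big_nil.
- by rewrite ev1 mon_eval1.
- by rewrite npoly_evalD IH1 IH2.
- by rewrite npoly_evalM IH1 IH2.
- by rewrite npoly_evalM1 mon_eval1 IH1 mulN1r.
- elim: n => [|n IH] /=; first by rewrite ev1 mon_eval1.
  by rewrite npoly_evalM IH1 IH exprS.
Qed.

(** Cancelled monomials stay in the list with coefficient 0, so the test is that every coefficient
    vanishes rather than that the list is empty. *)
Lemma nnorm_eq t1 t2 :
  all (fun t => t.1 == 0) (nnorm (NAdd t1 (NOpp t2))) -> neval t1 = neval t2.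
Proof.
move=> /allP t0; apply/subr0_eq; rewrite -[_ - _]/(neval (NAdd t1 (NOpp t2))).
rewrite -nnormE /npoly_eval big_seq big1 // => t /t0 /eqP ->.
by rewrite mulr0z.
Qed.

Fixpoint word_split (l w : seq nat) : option (seq nat * seq nat) :=
  if prefix l w then Some ([::], drop (size l) w) else
  if w is i :: w' then
    if word_split l w' is Some (u, v) then Some (i :: u, v) else None
  else None.

(* Rules whose left-hand side does not normalize to a word are ignored. *)
Fixpoint word_rewrite (rules : seq (nexp * nexp)) (w : seq nat)
    : option npoly :=
  if rules is (l, r) :: rules' then
    if nnorm l is [:: (Posz 1, ([::], l'))] then
      if word_split l' w is Some (u, v) then
        Some (npoly_mul [:: (1, ([::], u))]
                (npoly_mul (nnorm r) [:: (1, ([::], v))]))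
      else word_rewrite rules' w
    else word_rewrite rules' w
  else None.

Definition npoly_step rules (p : npoly) : npoly :=
  foldr (fun t => npoly_add
    (if word_rewrite rules t.2.2 is Some q then npoly_mul1 t.1 (t.2.1, [::]) q
     else [:: t])) [::] p.

Definition rules_hold (rules : seq (nexp * nexp)) : Prop :=
  foldr (fun lr P => neval lr.1 = neval lr.2 /\ P) True rules.

Lemma word_splitE l w u v : word_split l w = Some (u, v) -> w = u ++ l ++ v.
Proof.
elim: w u => [|i w IH] u; first by case: l => //= -[<- <-].
change (word_split l (i :: w)) with
  (if prefix l (i :: w) then Some ([::], drop (size l) (i :: w)) else
   if word_split l w is Some (u', v') then Some (i :: u', v') else None).
case: ifP => [/prefixP[w' ->] [<- <-]|_]; first by rewrite drop_size_cat.
by case: word_split IH => // -[u' v'] IH [<- vE]; rewrite (IH u') ?vE.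
Qed.

Lemma mon_eval_word w : mon_eval ([::], w) = word_eval w.
Proof. by rewrite /mon_eval /scal_eval big_nil mul1r. Qed.

Lemma npoly_eval_word w : npoly_eval [:: (1, ([::], w))] = word_eval w.
Proof. by rewrite /npoly_eval big_seq1 mon_eval_word. Qed.

Lemma word_rewriteE rules w q : rules_hold rules ->
  word_rewrite rules w = Some q -> npoly_eval q = word_eval w.
Proof.
elim: rules => [//|[l r] rules IH] [lr /IH{}IH].
rewrite /word_rewrite -/word_rewrite;
  case El: (nnorm l) => [|[[[|[|k]]|k] [[|i s'] l']] [|? ?]] //.
case Ew: word_split => [[u v]|] // /Some_inj <-.
have := nnormE l; rewrite El npoly_eval_word => lE.
rewrite !npoly_evalM !npoly_eval_word nnormE -lr -lE (word_splitE Ew).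
by rewrite /word_eval !big_cat.
Qed.

Lemma npoly_stepE rules p : rules_hold rules ->
  npoly_eval (npoly_step rules p) = npoly_eval p.
Proof.
move=> hr; elim: p => [//|[k [m w]] p IH] /=.
rewrite npoly_evalD IH [in RHS]/npoly_eval big_cons; congr (_ + _).
case Ew: word_rewrite => [q|]; last by rewrite /npoly_eval big_seq1.
rewrite npoly_evalM1 (word_rewriteE hr Ew) /mon_eval /=.
by rewrite /word_eval big_nil mulr1 mulrzAl.
Qed.

(** Soundness rests only on each round preserving the value of the polynomial; [fuel] merely counts
    the rounds. *)
Lemma nnorm_eq_mod rules fuel t1 t2 : rules_hold rules ->
  all (fun t => t.1 == 0)
    (iter fuel (npoly_step rules) (nnorm (NAdd t1 (NOpp t2)))) ->
  neval t1 = neval t2.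
Proof.
move=> hr /allP t0; apply/subr0_eq.
rewrite -[_ - _]/(neval (NAdd t1 (NOpp t2))) -nnormE.
suff <- : npoly_eval (iter fuel (npoly_step rules) (nnorm (NAdd t1 (NOpp t2))))
    = npoly_eval (nnorm (NAdd t1 (NOpp t2))).
  by rewrite /npoly_eval big_seq big1 // => t /t0 /eqP ->; rewrite mulr0z.
by elim: fuel {t0} => //= fuel <-; exact: npoly_stepE.
Qed.

End NoncommutativeNormalForm.

Ltac nc_index t l :=
  lazymatch l with
  | t :: _ => constr:(0%N)
  | _ :: ?l' => let i := nc_index t l' in constr:(S i)
  end.

Ltac nc_reify c x t :=
  lazymatch t with
  | (?u + ?v)%R => let u' := nc_reify c x u in let v' := nc_reify c x v in
                   constr:(NAdd u' v')
  | (?u * ?v)%R => let u' := nc_reify c x u in let v' := nc_reify c x v in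
                   constr:(NMul u' v')
  | (- ?u)%R => let u' := nc_reify c x u in constr:(NOpp u')
  | (?u ^+ ?n)%R => let u' := nc_reify c x u in constr:(NExp u' n)
  | kscal ?k => let i := nc_index k c in constr:(NScal i)
  | 0%R => constr:(NZero)
  | 1%R => constr:(NOne)
  | _ => let i := nc_index t x in constr:(NVar i)
  end.

(* Decides identities valid in every K-algebra, treating the listed scalars
   and variables as indeterminates. *)
Ltac nc_ring c x :=
  rewrite ?kscalE;
  lazymatch goal with
  | |- @eq ?T ?u ?v =>
    let u' := nc_reify c x u in let v' := nc_reify c x v in
    refine (@nnorm_eq _ _ c x u' v' _); vm_compute; reflexivity
  end.

Ltac nc_reify_rules c x T :=
  lazymatch T with
  | (?u = ?v) /\ ?T' =>
    let u' := nc_reify c x u in let v' := nc_reify c x v in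
    let r := nc_reify_rules c x T' in constr:((u', v') :: r)
  | True => constr:(@nil (nexp * nexp))
  end.

(* The same modulo the equations of H, applied as rewriting rules from left to
   right; the 20 rounds bound the length of a reduction. *)
Ltac nc_ring_mod c x H :=
  rewrite ?kscalE;
  lazymatch goal with
  | |- @eq ?T ?u ?v =>
    let u' := nc_reify c x u in let v' := nc_reify c x v in
    let TH := type of H in let r := nc_reify_rules c x TH in
    refine (@nnorm_eq_mod _ _ c x r 20 u' v' H _); vm_compute; reflexivity
  end.

(** * Products of eigenprojections *)

Lemma sum_distinct3 (V : nmodType) (F : 'I_3 -> V) x y z :
  uniq [:: x; y; z] -> \sum_w F w = F x + F y + F z.
Proof.
move=> xyz; have p3 : perm_eq (index_enum 'I_3) [:: x; y; z].
  rewrite perm_sym; apply: uniq_perm; rewrite ?index_enum_uniq // => w.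
  rewrite mem_index_enum; move: w x y z xyz.
  by do 4![case=> [[|[|[|//]]] ?] //].
by rewrite (perm_big _ p3) !big_cons big_nil /= addr0 addrA.
Qed.

Lemma distinct3_ex (x y : 'I_3) : x != y -> exists z, uniq [:: x; y; z].
Proof.
(* The three elements of Z/3 add up to 0. *)
move=> xy; exists (- (x + y)); move: x y xy.
by do 2![case=> [[|[|[|//]]] ?] //].
Qed.

Lemma distinct3P (x y z : 'I_3) :
  reflect [/\ x != y, x != z & y != z] (uniq [:: x; y; z]).
Proof. by rewrite /= !inE negb_or andbT -andbA; exact: and3P. Qed.

Lemma distinct3_rot (x y z : 'I_3) : uniq [:: x; y; z] -> uniq [:: y; z; x].
Proof. by rewrite -(rot_uniq 1). Qed.

Lemma distinct3_swap (x y z : 'I_3) : uniq [:: x; y; z] -> uniq [:: x; z; y].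
Proof. by case/distinct3P => xy xz yz; apply/distinct3P;
  rewrite [z == _]eq_sym. Qed.


Section Converse.
Variables (K : pzRingType) (A : kalgType K).

(** The converse algebra is again a K-algebra, so a vanishing result proved for all algebras also
    yields its left-right mirror image. *)
Fact converse_kscalM : {morph (@kscal K A : K -> A^c) : x y / x * y}.
Proof. by move=> x y; rewrite kscalM kscalC. Qed.

Fact converse_kscalC (x : K) (u : A^c) :
  ((kscal x : A) : A^c) * u = u * ((kscal x : A) : A^c).
Proof. exact: esym (kscalC x (u : A)). Qed.

HB.instance Definition _ := isKAlgebra.Build K A^c
  (@kscalB K A) (@kscal1 K A) converse_kscalM converse_kscalC.
End Converse.

Section Spectral.
Variables (K : fieldType) (lam : 'I_3 -> K) (A : kalgType K).
Hypotheses (lam_inj : injective lam) (lam_neq0 : forall x, lam x != 0).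
Implicit Types (s t u : A) (e f g : 'I_3 -> A) (x y z : 'I_3).

(** A complete system of eigenprojections. Idempotence follows from orthogonality and the sum being
    1 (see [spectral_id]). A member may be zero, which means that the eigenvalue is missing. *)
Definition spectral s e : Prop :=
  [/\ forall x y, x != y -> e x * e y = 0, \sum_x e x = 1
    & forall x, s * e x = (lam x)%:S * e x].

(** The definition only gives the action of [s] from the left. Inserting the sum of all [e y] after
    [s], orthogonality leaves the term of [x]. *)
Lemma spectralV s e : spectral s e -> forall x, e x * s = (lam x)%:S * e x.
Proof.
case=> e0 e1 se x; rewrite -[s]mulr1 -e1 !mulr_sumr (bigD1 x) //= big1 =>
  [|y yx].
  rewrite addr0 se kscalCA; congr (_ * _).
  by rewrite -[RHS]mulr1 -e1 mulr_sumr (bigD1 x) //= big1 ?addr0 // => y yx;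
    rewrite e0 // eq_sym.
by rewrite se kscalCA e0 ?mulr0 // eq_sym.
Qed.

Lemma spectral_sum s e x y z :
  spectral s e -> uniq [:: x; y; z] -> e x + e y + e z = 1.
Proof. by case=> _ + _ xyz; rewrite (sum_distinct3 _ xyz). Qed.

Lemma spectral_sub s e x y z :
  spectral s e -> uniq [:: x; y; z] -> e y = 1 - e x - e z.
Proof. 
by move=> se xyz; rewrite -(spectral_sum se xyz) addrAC [e x + _]addrC addrK
  addrK.
Qed.

Lemma spectral_id s e x : spectral s e -> e x * e x = e x.
Proof.
case=> e0 e1 _; rewrite -[RHS]mulr1 -e1 mulr_sumr (bigD1 x) //= big1 ?addr0 //.
by move=> y yx; rewrite e0 // eq_sym.
Qed.

Lemma spectral_decomp s e : spectral s e -> s = \sum_x (lam x)%:S * e x.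
Proof.
case=> _ e1 se; rewrite -[LHS]mulr1 -e1 mulr_sumr; apply: eq_bigr => x _.
exact: se.
Qed.

Lemma missing_eigenvalue_quadratic s e x y z : spectral s e ->
  uniq [:: x; y; z] -> e x = 0 -> (s - (lam y)%:S) * (s - (lam z)%:S) = 0.
Proof.
move=> se xyz ex; have [_ _ eS] := se.
have eB k w : (s - k%:S) * e w = (lam w - k)%:S * e w.
  by rewrite mulrBl eS kscalB mulrBl.
rewrite -[LHS]mulr1 -(spectral_sum se xyz) ex add0r -mulrA mulrDr !eB.
by rewrite subrr kscal0 mul0r addr0 kscalCA eB subrr kscal0 mul0r mulr0.
Qed.

(* e_x b e_z is a multiple of e_x (t - x) (t - z) e_z, where the middle factor
   is a multiple of f_y. *)
Lemma path_vanish s t e f x y z : spectral s e -> spectral t f ->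
    t ^+ 2 * s - s * t ^+ 2 - t * s ^+ 2 + s ^+ 2 * t = 0 ->
  uniq [:: x; y; z] -> e x * f y * e z = 0.
Proof.
move=> se tf b0 xyz; have [e0 _ eS] := se; have [f0 _ fS] := tf.
have [xy xz yz] := distinct3P _ _ _ xyz.
have lamB (u v : 'I_3) : u != v -> lam u - lam v != 0.
  by move=> uv; rewrite subr_eq0 (inj_eq lam_inj).
have tE : (t - (lam x)%:S) * (t - (lam z)%:S)
        = ((lam y - lam x) * (lam y - lam z))%:S * f y.
  have tB k w : (t - k%:S) * f w = (lam w - k)%:S * f w.
    by rewrite mulrBl fS kscalB mulrBl.
  rewrite -[LHS]mulr1 -(spectral_sum tf xyz) -mulrA !mulrDr !tB !kscalCA !tB.
  by rewrite !subrr kscal0 !mul0r !mulr0 add0r addr0; nc_ring [:: lam x;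
    lam y; lam z] [:: f y].
have : ((lam z - lam x) * ((lam y - lam x) * (lam y - lam z)))%:S
         * (e x * f y * e z) = 0.
  have es := spectralV se x; have sz := eS z; have xz0 := e0 _ _ xz.
  transitivity ((lam z - lam x)%:S
    * (e x * (((lam y - lam x) * (lam y - lam z))%:S * f y) * e z)).
    by nc_ring [:: lam x; lam y; lam z] [:: e x; f y; e z].
  rewrite -tE.
  (* The last summand is zero because [e x * e z = 0]; it supplies the constant term of the
     quadratic polynomial in [t], which is absent from e_x b e_z. *)
  transitivity (e x * t ^+ 2 * (s * e z) - e x * s * t ^+ 2 * e z
    - e x * t * s * (s * e z) + e x * s * s * t * e z
    + ((lam z - lam x) * lam x * lam z)%:S * (e x * e z)); last first.
    rewrite xz0 mulr0 addr0 -[RHS](mul0r (e z)) -[in RHS](mulr0 (e x)) -b0.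
    by nc_ring (@nil K) [:: e x; e z; s; t].
  rewrite !es !sz.
  transitivity ((lam z)%:S * e x * t ^+ 2 * e z - (lam x)%:S * e x * t ^+ 2 * e
    z
    - (lam z)%:S * e x * t * (s * e z) + (lam x)%:S * (e x * s) * t * e z
    + ((lam z - lam x) * lam x * lam z)%:S * (e x * e z)); last first.
    by nc_ring [:: lam x; lam z] [:: e x; e z; s; t].
  by rewrite !es !sz; nc_ring [:: lam x; lam z] [:: e x; e z; s; t].
by apply: kscal_regular; rewrite !mulf_neq0 ?lamB // eq_sym.
Qed.

(** As [f x + f y = 1 - f z] and [e x * f z * e y = 0], the two products add up to
    [e x * e y = 0]. *)
Lemma path_shift s t e f x y : spectral s e -> spectral t f ->
  (forall x y z, uniq [:: x; y; z] -> e x * f y * e z = 0) ->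
  x != y -> e x * f x * e y = - (e x * f y * e y).
Proof.
move=> se tf P xy; have [z xyz] := distinct3_ex xy; have [e0 _ _] := se.
apply/eqP; rewrite -addr_eq0 -mulrDl -mulrDr -[_ + _](addrK (f z)).
by rewrite (spectral_sum tf xyz) mulrBr mulrBl mulr1 e0 // (P _ _ _
  (distinct3_swap xyz)) subrr.
Qed.

(* Since x != y, the braid relation forces e_x(s) t s e_y(t) = 0; the stated
   formula is the expansion of this product over the eigenprojections. *)
Lemma braid_absorb s t e f x y : spectral s e -> spectral t f ->
  (forall x y z, uniq [:: x; y; z] -> e x * f y * e z = 0) ->
  (forall x y z, uniq [:: x; y; z] -> f x * e y * f z = 0) ->
  s * t * s = t * s * t -> x != y ->
  e x * f y * e y * f y
    = (- (lam x * lam y) / (lam x - lam y) ^+ 2)%:S * (e x * f y).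
Proof.
move=> se tf P P' br xy; have [z xyz] := distinct3_ex xy.
have [e0 _ eS] := se; have [f0 _ fS] := tf.
have xyB : lam x - lam y != 0 by rewrite subr_eq0 (inj_eq lam_inj).
have ex := spectralV se x.
have st0 : e x * t * s * f y = 0.
  apply: (kscal_regular xyB).
  transitivity ((lam x)%:S * e x * t * s * f y - e x * t * s * ((lam y)%:S * f
    y)).
    by nc_ring [:: lam x; lam y] [:: e x; f y; s; t].
  rewrite -ex -fS -[RHS](mul0r (f y)) -[in RHS](mulr0 (e x)) -(subrr (s * t *
    s)).
  by rewrite {2}br; nc_ring (@nil K) [:: e x; f y; s; t].
have tS := spectral_decomp tf; rewrite (sum_distinct3 _ xyz) in tS.
have sS := spectral_decomp se; rewrite (sum_distinct3 _ xyz) in sS.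
have [_ xz yz] := distinct3P _ _ _ xyz.
have xzy := distinct3_swap xyz; have yzx := distinct3_rot xyz.
have zxy := distinct3_rot yzx; have yxz := distinct3_swap yzx.
(* Each of the nine words [e x * f v * e w * f y] in the expansion of [e x * t * s * f y] is 0 or a
   combination of [p] and [n]. *)
set p := e x * f y * e y * f y; set n := e x * f y.
have Exy : e x * f x * e y * f y = - p by rewrite (path_shift se tf) ?mulNr.
have Exx : e x * f x * e x * f y = p.
  by rewrite -[RHS]opprK -Exy -!mulrA -mulrN (mulrA (f x)) (path_shift tf se)
    ?mulrA.
have Exz : e x * f x * e z * f y = 0 by rewrite -!mulrA [f x * _]mulrA P'
  ?mulr0.
have Eyz : e x * f y * e z * f y = 0 by rewrite P ?mul0r.
have Eyx : e x * f y * e x * f y = n - p.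
  have n1 : n = n * (e x + e y + e z) * f y.
    by rewrite (spectral_sum se xyz) mulr1 -mulrA (spectral_id _ tf).
  by rewrite [n in RHS]n1 !mulrDr !mulrDl Eyz addr0 addrK.
have Ezx : e x * f z * e x * f y = 0 by rewrite -!mulrA [f z * _]mulrA P'
  ?mulr0.
have Ezy : e x * f z * e y * f y = 0 by rewrite P ?mul0r.
have Ezz : e x * f z * e z * f y = 0.
  rewrite -!mulrA [f z * _]mulrA (path_shift tf se) 1?eq_sym //.
  by rewrite mulrN !mulrA Ezy oppr0.
(* Collecting the nine words, the vanishing product becomes (lam x - lam y)^2 p + (lam x)(lam y)
   n. *)
have pn : ((lam x - lam y) ^+ 2)%:S * p = (- (lam x * lam y))%:S * n.
  apply/eqP; rewrite -subr_eq0 -{}st0; apply/eqP; rewrite tS sS.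
  transitivity ((lam x * lam x)%:S * (e x * f x * e x * f y)
    + (lam x * lam y)%:S * (e x * f x * e y * f y)
    + (lam x * lam z)%:S * (e x * f x * e z * f y)
    + (lam y * lam x)%:S * (e x * f y * e x * f y) + (lam y * lam y)%:S * p
    + (lam y * lam z)%:S * (e x * f y * e z * f y)
    + (lam z * lam x)%:S * (e x * f z * e x * f y)
    + (lam z * lam y)%:S * (e x * f z * e y * f y)
    + (lam z * lam z)%:S * (e x * f z * e z * f y)).
    by rewrite Exx Exy Exz Eyx Eyz Ezx Ezy Ezz; nc_ring [:: lam x; lam y;
      lam z] [:: p; n].
  rewrite /p.
  by nc_ring [:: lam x; lam y; lam z] [:: e x; e y; e z; f x; f y; f z].
rewrite -/n [_ / _]mulrC kscalM -mulrA -pn kscalMK //.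
by rewrite mulVf // expf_neq0.
Qed.



(** An element commuting with [s] is block diagonal: [e y * u * e z] is multiplied by [lam y] or by
    [lam z] according to the side on which [s] is moved, hence vanishes for y != z. *)
Lemma spectral_comm s e u x : spectral s e -> s * u = u * s ->
  e x * u = u * e x.
Proof.
move=> se su; have [_ e1 eS] := se; have eV := spectralV se.
have e0 y z : y != z -> e y * u * e z = 0.
  move=> yz; have : (lam y - lam z)%:S * (e y * u * e z) = 0.
    transitivity ((lam y)%:S * e y * u * e z - e y * u * ((lam z)%:S * e z)).
      by nc_ring [:: lam y; lam z] [:: e y; e z; u].
    rewrite -(eS z) -(eV y); apply/eqP; rewrite subr_eq0; apply/eqP.
    by rewrite -(mulrA (e y) s) su !mulrA.
  by apply: kscal_regular; rewrite subr_eq0 (inj_eq lam_inj).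
transitivity (e x * u * e x).
  rewrite -[LHS]mulr1 -e1 mulr_sumr (bigD1 x) //= big1 ?addr0 // => y yx.
  by rewrite e0 // eq_sym.
rewrite -[RHS]mul1r -e1 mulr_suml (bigD1 x) //= big1 ?addr0 ?mulrA // => y yx.
by rewrite mulrA e0.
Qed.

Definition cubic_pair s t : Prop :=
  s * t * s = t * s * t /\
  t ^+ 2 * s - s * t ^+ 2 - t * s ^+ 2 + s ^+ 2 * t = 0.

(** The element b is invariant under exchanging the two generators. *)
Lemma cubic_pair_sym s t : cubic_pair s t -> cubic_pair t s.
Proof.
case=> br b0; split; first exact: esym.
by rewrite -b0; nc_ring (@nil K) [:: s; t].
Qed.

Lemma pair_vanish s t e f : spectral s e -> spectral t f -> cubic_pair s t ->
  forall x y z, uniq [:: x; y; z] -> e x * f y * e z = 0.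
Proof. by move=> se tf [_ b0] x y z; exact: path_vanish b0. Qed.

(** This is where invertibility of the eigenvalues enters: the constant of [braid_absorb] is nonzero
    because they are nonzero and distinct. *)
Lemma pair_absorb s t e f : spectral s e -> spectral t f -> cubic_pair s t ->
  forall x y, x != y -> exists2 k : K, k != 0
    & e x * f y * e y * f y = k%:S * (e x * f y).
Proof.
move=> se tf st x y xy; have [br _] := st.
exists (- (lam x * lam y) / (lam x - lam y) ^+ 2); last first.
  exact: braid_absorb (pair_vanish se tf st)
    (pair_vanish tf se (cubic_pair_sym st)) br xy.
by rewrite mulf_neq0 ?oppr_eq0 ?mulf_neq0 ?invr_eq0 ?expf_neq0 // subr_eq0
  (inj_eq lam_inj).
Qed.

(* With r = e_x(s) e_z(u) e_y(t), the eigenvectors p = r e_y(s) and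
   q = r e_y(u) satisfy p e_x(t) = p - k r; the left side has no component
   along e_y(u), whence q = 0, and r is a multiple of q e_y(t). *)
Lemma commuting_vanish s t u e f g x y z :
  spectral s e -> spectral t f -> spectral u g ->
  cubic_pair s t -> cubic_pair u t -> s * u = u * s ->
  uniq [:: x; y; z] -> e x * g z * f y = 0.
Proof.
move=> se tf ug st ut su xyz.
have [xy xz yz] := distinct3P _ _ _ xyz.
have [e0 e1 eS] := se; have [f0 f1 fS] := tf; have [g0 g1 gS] := ug.
have eg v w : e v * g w = g w * e v.
  by apply: (spectral_comm _ se); apply/esym/(spectral_comm _ ug)/esym.
have eft := pair_vanish se tf st; have gft := pair_vanish ug tf ut.
have fef := pair_vanish tf se (cubic_pair_sym st).
have zxy := distinct3_rot (distinct3_rot xyz); have zyx := distinct3_swap zxy.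
have zy : z != y by rewrite eq_sym.
have [k k0 ek] := pair_absorb se tf st xy.
have [l l0 el] := pair_absorb ug tf ut zy.
set r := e x * g z * f y.
have rE : r = g z * (e x * f y) by rewrite /r eg -mulrA.
set p := r * e y.
have rgx : r * g x = 0 by rewrite /r -!mulrA (mulrA (g z)) gft ?mulr0.
have pgx : p * g x = 0 by rewrite /p -mulrA eg mulrA rgx mul0r.
have pgy : p * g y = 0.
  (* Trading [f y] for [f x] by [path_shift] exposes [g z * f x * g y], which vanishes for the pair
     of [u] and [t]. *)
  have pE : p = - (e x * (g z * f x) * e y).
    rewrite /p rE -!mulrA (mulrA (e x)) -[_ * e y]opprK -(path_shift se tf eft
      xy).
    by rewrite mulrN !mulrA eg.
  by rewrite pE mulNr -!mulrA eg (mulrA (f x)) (mulrA (g z)) (mulrA (g z)) gft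
    // mul0r mulr0 oppr0.
have pgz : p * g z = p.
  by rewrite -[RHS]mulr1 -(spectral_sum ug xyz) !mulrDr pgx pgy !add0r.
have pfz : p * f z = 0.
  have ft : f y * e y * f z = - (f y * e z * f z).
    by rewrite (path_shift tf se fef yz).
  by rewrite /p rE -!mulrA (mulrA (f y)) ft !mulrN (mulrA (e x)) (mulrA (e x))
    eft // mul0r mulr0 oppr0.
have pfy : p * f y = k%:S * r.
  by rewrite /p rE -!mulrA (mulrA (e x)) (mulrA (e x * _)) ek kscalCA.
have pfx : p * f x = p - k%:S * r.
  apply: (addIr (p * f y)); rewrite [in RHS]pfy subrK -[RHS]mulr1.
  by rewrite -(spectral_sum tf xyz) !mulrDr pfz addr0.
clearbody p; have rgy : r * g y = 0.
  apply: (kscal_regular k0).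
  have : p * f x * g y = 0.
    by rewrite -pgz -!mulrA (mulrA (g z)) gft ?mulr0.
  by rewrite pfx mulrBl pgy sub0r mulrA => /eqP; rewrite oppr_eq0 => /eqP.
apply: (kscal_regular l0).
by rewrite -/r /r -(mulrA (e x)) -kscalCA -el !mulrA -/r rgy mul0r.
Qed.


End Spectral.

Lemma spectral_converse (K : fieldType) (lam : 'I_3 -> K) (A : kalgType K)
    (s : A) e : spectral lam s e -> @spectral K lam A^c s e.
Proof.
move=> se; have [e0 e1 _] := se; split=> // [x y xy|x].
  by apply: e0; rewrite eq_sym.
exact: etrans (spectralV se x) (kscalC _ _).
Qed.

(** Reversing words preserves the braid relation and changes the sign of b. *)
Lemma cubic_pair_converse (K : fieldType) (A : kalgType K) (s t : A) :
  cubic_pair s t -> @cubic_pair K A^c s t.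
Proof.
case=> br b0; split; first by rewrite /GRing.mul /= !mulrA.
apply: (oppr_inj); rewrite oppr0 -[RHS]b0 /= !expr2.
change (- (s * (t * t) - (t * t) * s - (s * s) * t + t * (s * s))
  = t * t * s - s * (t * t) - t * (s * s) + s * s * t :> A).
by nc_ring (@nil K) [:: s; t].
Qed.

Section Chain.
Variables (K : fieldType) (lam : 'I_3 -> K) (A : kalgType K).
Hypotheses (lam_inj : injective lam) (lam_neq0 : forall x, lam x != 0).

(** Mirror image of [commuting_vanish], read in the converse algebra after exchanging the two
    commuting projections. *)
Lemma commuting_vanishr s t u e f g x y z :
  spectral lam (s : A) e -> spectral lam t f -> spectral lam u g ->
  cubic_pair s t -> cubic_pair u t -> s * u = u * s ->
  uniq [:: x; y; z] -> f y * e x * g z = 0.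
Proof.
move=> se tf ug st ut su xyz.
have eg : e x * g z = g z * e x.
  by apply: (spectral_comm lam_inj _ se);
    apply/esym/(spectral_comm lam_inj _ ug)/esym.
rewrite -mulrA eg.
exact: (commuting_vanish lam_inj lam_neq0 (spectral_converse se)
  (spectral_converse tf) (spectral_converse ug) (cubic_pair_converse st)
  (cubic_pair_converse ut) (esym su) xyz).
Qed.

(** Insert [e x + e y + e z] before [g z]. The term of [e z] vanishes for the pair of [s] and [t].
    The term of [e x] contains [f y * e x * g z], and that of [e y], after [path_shift], contains
    [f x * e y * g z]; both vanish by [commuting_vanishr]. *)
Lemma chain_vanish s t u e f g x y z :
  spectral lam (s : A) e -> spectral lam t f -> spectral lam u g ->
  cubic_pair s t -> cubic_pair u t -> s * u = u * s ->
  uniq [:: x; y; z] -> e x * f y * g z = 0.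
Proof.
move=> se tf ug st ut su xyz; have [xy _ _] := distinct3P _ _ _ xyz.
have fxyz w v : uniq [:: w; v; z] -> f v * e w * g z = 0.
  exact: (commuting_vanishr se tf ug).
have eft := pair_vanish lam_inj se tf st.
have efe : e x * f y * e y = - (e x * f x * e y).
  by rewrite (path_shift se tf eft xy) opprK.
rewrite -[e x * f y]mulr1 -(spectral_sum se xyz) !mulrDr !mulrDl efe.
rewrite -(mulrA (e x)) -mulrA fxyz // mulr0 add0r.
rewrite (eft _ _ _ xyz) mul0r addr0 mulNr -!mulrA (mulrA (f x)) fxyz ?mulr0
  ?oppr0 //.
exact: distinct3_swap (distinct3_rot xyz).
Qed.

Variables (n : nat) (s : nat -> A) (e : nat -> 'I_3 -> A).
Hypothesis n4 : (n <= 4)%N.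
Hypothesis se : forall i, (0 < i < n)%N -> spectral lam (s i) (e i).
Hypothesis s_adj : forall i, (0 < i)%N -> (i.+1 < n)%N -> cubic_pair (s i) (s
  i.+1).
Hypothesis s_far : forall i j, (0 < i)%N -> (i.+1 < j)%N -> (j < n)%N -> s i *
  s j = s j * s i.

Lemma triple_vanish i j k x y z : (0 < i < n)%N -> (0 < j < n)%N ->
  (0 < k < n)%N -> uniq [:: x; y; z] -> e i x * e j y * e k z = 0.
Proof.
move=> hi hj hk xyz; have [xy xz yz] := distinct3P _ _ _ xyz.
case: (eqVneq i j) => [->|ij]; first by have [-> //] := se hj; rewrite mul0r.
case: (eqVneq j k) => [->|jk]; first by have [e0 _ _] := se hk;
  rewrite -mulrA e0 ?mulr0.
have far v w (hv : (0 < v)%N) (vw : (v.+1 < w)%N) (hw : (w < n)%N) q r :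
  e v q * e w r = e w r * e v q.
  have hv' : (0 < v < n)%N by lia.
  have hw' : (0 < w < n)%N by lia.
  apply: (spectral_comm lam_inj _ (se hv')); apply/esym.
  by apply: (spectral_comm lam_inj _ (se hw')); apply/esym/s_far.
have pair v w (hv : (0 < v < n)%N) (hw : (0 < w < n)%N) (vw : w = v.+1 \/ v =
  w.+1) :
    cubic_pair (s v) (s w).
  case: vw => vw; rewrite vw in hv hw *.
    by apply: s_adj; lia.
  by apply/cubic_pair_sym/s_adj; lia.
case: (eqVneq i k) hk jk => [<- _ _|ik hk jk].
  have [ij1|ij2] : (j = i.+1 \/ i = j.+1) \/ (i.+1 < j \/ j.+1 < i)%N by lia.
    exact: (pair_vanish lam_inj (se hi) (se hj) (pair _ _ hi hj ij1)).
  have [e0 _ _] := se hi.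
  have -> : e i x * e j y = e j y * e i x.
    by case: ij2 => ?; [|symmetry]; apply: far; lia.
  by rewrite -mulrA e0 ?mulr0.
have far_comm v w : (0 < v < n)%N -> (0 < w < n)%N -> (v.+1 < w \/ w.+1 < v)%N
  -> s v * s w = s w * s v.
  by move=> hv hw; case=> ?; [|symmetry]; apply: s_far; lia.
(* Being distinct and below 4, the indices are 1, 2, 3 in some order; the cases tell whether the
   middle generator s_2 is at place j, i or k. *)
have [[ij1 jk1]|[[ij1 ik1]|[jk1 ik1]]] :
  ((j = i.+1 \/ i = j.+1) /\ (j = k.+1 \/ k = j.+1)) \/
  ((j = i.+1 \/ i = j.+1) /\ (i = k.+1 \/ k = i.+1)) \/
  ((k = j.+1 \/ j = k.+1) /\ (i = k.+1 \/ k = i.+1)) by lia.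
- apply: (chain_vanish (se hi) (se hj) (se hk)) => //.
  + exact: pair.
  + by apply: pair => //; lia.
  + by apply: far_comm => //; lia.
- apply: (commuting_vanishr (se hj) (se hi) (se hk)) => //.
  + by apply: pair => //; lia.
  + by apply: pair => //; lia.
  + by apply: far_comm => //; lia.
  + exact: distinct3_swap (distinct3_rot xyz).
- apply: (commuting_vanish lam_inj lam_neq0 (se hi) (se hk) (se hj)) => //.
  + by apply: pair => //; lia.
  + by apply: pair => //; lia.
  + by apply: far_comm => //; lia.
  + exact: distinct3_swap.
Qed.
End Chain.

(** * Missing eigenvalues in prime quotients *)

Section PrimeQuotient.
Variables (K : fieldType) (lam : 'I_3 -> K) (A : kalgType K) (n : nat).
Variables (s : nat -> A) (e : nat -> 'I_3 -> A).
Hypothesis n_gt1 : (1 < n)%N.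
Hypothesis se : forall i, (0 < i < n)%N -> spectral lam (s i) (e i).
Hypothesis triple : forall i j k x y z, (0 < i < n)%N -> (0 < j < n)%N ->
  (0 < k < n)%N -> uniq [:: x; y; z] -> e i x * e j y * e k z = 0.
Hypothesis generated : forall P : A -> Prop, P 1 ->
  (forall u v, P u -> P v -> P (u + v)) -> (forall k u, P u -> P (k%:S * u)) ->
  (forall i u, (0 < i < n)%N -> P u -> P (s i * u)) -> forall u, P u.

(** A new letter s_l is split along its eigenprojections. All indices and eigenvalues are
    generalised in the induction, since the hypothesis is reused at [j], [l] and at [i], [l]. *)
Lemma word_vanish (u : A) i j k x y z : (0 < i < n)%N -> (0 < j < n)%N ->
  (0 < k < n)%N -> uniq [:: x; y; z] -> e i x * e j y * u * e k z = 0.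
Proof.
pose P (u : A) := forall i j k x y z, (0 < i < n)%N -> (0 < j < n)%N ->
  (0 < k < n)%N -> uniq [:: x; y; z] -> e i x * e j y * u * e k z = 0.
suff: P u by exact.
elim/generated: {i j k x y z} u =>
  [i j k x y z hi hj hk xyz|u v Pu Pv|c u Pu|l u hl Pu].
- by rewrite mulr1 triple.
- by move=> i j k x y z *; rewrite mulrDr mulrDl Pu ?Pv ?addr0.
- by move=> i j k x y z *; rewrite kscalCA -mulrA Pu ?mulr0.
move=> i j k x y z hi hj hk xyz; have [xy xz yz] := distinct3P _ _ _ xyz.
have yxz := distinct3_swap (distinct3_rot xyz).
have Ex : e i x * e j y * e l x * u * e k z = 0.
  by rewrite -!(mulrA (e i x)) Pu ?mulr0.
have Ez : e i x * e j y * e l z * u * e k z = 0 by rewrite triple ?mul0r.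
(* Writing [e j y] as [1 - e j x - e j z] leaves two terms killed by the inductive hypothesis and
   one killed by [triple]. *)
have Ey : e i x * e j y * e l y * u * e k z = 0.
  rewrite (spectral_sub (se hj) xyz) !(mulrBr, mulrBl) mulr1 Pu //.
  have xzy := distinct3_swap xyz.
  rewrite (triple hi hj hl xzy) !mul0r subr0 -!(mulrA (e i x)).
  by rewrite Pu // mulr0 subr0.
rewrite (spectral_decomp (se hl)) (sum_distinct3 _ xyz).
transitivity ((lam x)%:S * (e i x * e j y * e l x * u * e k z)
  + (lam y)%:S * (e i x * e j y * e l y * u * e k z)
  + (lam z)%:S * (e i x * e j y * e l z * u * e k z)).
  nc_ring [:: lam x; lam y; lam z]
    [:: e i x; e j y; e l x; e l y; e l z; u; e k z].
by rewrite Ex Ey Ez !mulr0 !addr0.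
Qed.

Hypothesis prime : forall u v : A, (forall w, u * w * v = 0) -> u = 0 \/ v = 0.

(** If no projection of s_1 vanished, primeness and [word_vanish] would make [e i x] and [e j y]
    orthogonal for all i, j and x != y. Then [e 1 x] would be an eigenvector of every generator
    acting from the right, so two different projections of s_1 would annihilate each other through
    every word, against primeness. *)
Lemma prime_missing_eigenvalue : exists x, e 1 x = 0.
Proof.
case: (pselect (exists x, e 1 x = 0)) => // none.
have e1n x : e 1 x <> 0 by move=> e1x; apply: none; exists x.
have orth i j x y : (0 < i < n)%N -> (0 < j < n)%N -> x != y -> e i x * e j y =
  0.
  move=> hi hj xy; have [z xyz] := distinct3_ex xy.
  have /prime[//|/e1n[]] w : e i x * e j y * w * e 1 z = 0.
  exact: word_vanish.
pose o0 : 'I_3 := ord0; pose o1 : 'I_3 := lift ord0 ord0.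
have o01 : o0 != o1 by [].
suff /prime[/e1n[]|/e1n[]] u : e 1 o0 * u * e 1 o1 = 0.
elim/generated: u => [|u v Pu Pv|c u Pu|l u hl Pu].
- by rewrite mulr1 orth.
- by rewrite mulrDr mulrDl Pu Pv addr0.
- by rewrite kscalCA -mulrA Pu mulr0.
have es : e 1 o0 * s l = (lam o0)%:S * e 1 o0.
  rewrite -[RHS]mulr1; have [_ <- _] := se hl.
  rewrite (spectral_decomp (se hl)) !mulr_sumr; apply: eq_bigr => x _.
  rewrite kscalCA -mulrA; case: (eqVneq x o0) => [-> //|xo].
  by rewrite orth ?mulr0 // eq_sym.
by rewrite mulrA es -!mulrA (mulrA (e 1 o0)) Pu mulr0.
Qed.
End PrimeQuotient.

Definition lam3 (K : fieldType) (a b c : K) (i : 'I_3) : K := [:: a; b; c]`_i.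

Section SpectralExists.
Variables (K : fieldType) (a b c : K) (A : kalgType K) (s : A).
Hypothesis abc : (a - b) * (a - c) * (b - c) != 0.

Lemma lam3_inj : injective (lam3 a b c).
Proof.
move: abc; rewrite !mulf_eq0 !negb_or !subr_eq0 => /andP[/andP[ab ac] bc].
by do 2![case=> [[|[|[|//]]] ?]]; rewrite /lam3 /= => e;
  try (by apply: val_inj); move: ab ac bc; rewrite e eqxx ?andbF.
Qed.

Lemma cubic_spectral :
  (s - a%:S) * (s - b%:S) * (s - c%:S) = 0 -> exists e,
    spectral (lam3 a b c) s e.
Proof.
move=> cub; move: (abc); rewrite !mulf_eq0 !negb_or => /andP[/andP[ab ac] bc].
(* The Lagrange interpolation polynomials at a, b, c, evaluated at [s]. *)
pose e (i : 'I_3) : A := 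
  [:: ((a - b) * (a - c))^-1%:S * ((s - b%:S) * (s - c%:S));
      ((b - a) * (b - c))^-1%:S * ((s - a%:S) * (s - c%:S));
      ((c - a) * (c - b))^-1%:S * ((s - a%:S) * (s - b%:S))]`_i.
have eS x : s * e x = (lam3 a b c x)%:S * e x.
  apply/eqP; rewrite -subr_eq0 -mulrBl; apply/eqP.
  case: x => [[|[|[|//]]] ?]; rewrite /e /lam3 /= kscalCA;
    apply: etrans (mulr0 (_^-1)%:S); congr (_ * _); rewrite -cub;
    nc_ring [:: a; b; c] [:: s].
have ba : b - a != 0 by rewrite -opprB oppr_eq0.
have ca : c - a != 0 by rewrite -opprB oppr_eq0.
have cb : c - b != 0 by rewrite -opprB oppr_eq0.
have e1 : \sum_x e x = 1.
  rewrite !big_ord_recl big_ord0 /e /= addr0.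
  set p := _^-1; set q := _^-1; set r := _^-1.
  (* The three coefficients are those of the polynomial interpolating the constant 1. *)
  transitivity ((p + q + r)%:S * s ^+ 2
    - (p * (b + c) + q * (a + c) + r * (a + b))%:S * s
    + (p * (b * c) + q * (a * c) + r * (a * b))%:S).
    by nc_ring [:: a; b; c; p; q; r] [:: s].
  have -> : p + q + r = 0 by rewrite /p /q /r; field; rewrite ab ac bc ba ca cb.
  have -> : p * (b + c) + q * (a + c) + r * (a + b) = 0.
    by rewrite /p /q /r; field; rewrite ab ac bc ba ca cb.
  have -> : p * (b * c) + q * (a * c) + r * (a * b) = 1.
    by rewrite /p /q /r; field; rewrite ab ac bc ba ca cb.
  by rewrite kscal0 kscal1 !mul0r subr0 add0r.
have se x : s * e x = e x * s.
  by case: x => [[|[|[|//]]] ?]; rewrite /e /=; set p := _^-1;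
    nc_ring [:: a; b; c; p] [:: s].
exists e; split=> // x y xy.
have : (lam3 a b c x - lam3 a b c y)%:S * (e x * e y) = 0.
  by rewrite kscalB mulrBl mulrA -eS -kscalCA -eS mulrA se subrr.
by apply: kscal_regular; rewrite subr_eq0 (inj_eq lam3_inj).
Qed.
End SpectralExists.

(** * Group algebras of braid groups *)

Section BraidAlgebra.
Variables (K : fieldType) (n : nat).
Local Notation KB := (KB K n).
Local Notation s := (sB K n).

Lemma ga_ofM (G : groupType) (g h : G) :
  ga_of K (g * h)%g = ga_of K g * ga_of K h.
Proof. by rewrite [RHS]ga_mulUU mulr1. Qed.

Definition sBV (i : nat) : KB := ga_of K (artin n i)^-1%g.

Lemma sBK i : s i * sBV i = 1.
Proof. by rewrite -ga_ofM mulgV. Qed.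

Lemma artinE i (hi : (0 < i < n)%N) :
  artin n i = pres_class (@braid_rel n) [:: (exist _ i hi, true)].
Proof. by rewrite /artin insubT. Qed.

Lemma pres_classM (X : choiceType) R (u v : seq (X * bool)) :
  pres_class R (u ++ v) = (pres_class R u * pres_class R v)%g.
Proof. exact: esym (pres_mulE _ _ _). Qed.

Lemma sB_braid i : (0 < i)%N -> (i.+1 < n)%N ->
  s i * s i.+1 * s i = s i.+1 * s i * s i.+1.
Proof.
move=> i0 iSn; have hi : (0 < i < n)%N by rewrite i0 ltnW.
rewrite /sB -!ga_ofM (artinE hi) (artinE (i := i.+1) iSn) -!pres_classM.
congr ga_of; apply/presentedP.
have := @pres_rel _ (@braid_rel n) [::] [::] _ _ (@braid_adj n (exist _ i hi)
  (exist _ i.+1 iSn) (erefl _)).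
by rewrite /= .
Qed.

Lemma sB_far i j : (0 < i)%N -> (i.+1 < j)%N -> (j < n)%N ->
  s i * s j = s j * s i.
Proof.
move=> i0 ij jn; have hi : (0 < i < n)%N by lia.
have hj : (0 < j < n)%N by lia.
rewrite /sB -!ga_ofM (artinE hi) (artinE hj) -!pres_classM.
congr ga_of; apply/presentedP.
exact: (@pres_rel _ (@braid_rel n) [::] [::] _ _ (@braid_far n (exist _ i hi)
  (exist _ j hj) ij)).
Qed.

Lemma KB_ind (P : KB -> Prop) : P 1 -> (forall u v, P u -> P v -> P (u + v)) ->
  (forall k u, P u -> P (k%:S * u)) ->
  (forall i u, (0 < i < n)%N -> P u -> P (s i * u)) ->
  (forall i u, (0 < i < n)%N -> P u -> P (sBV i * u)) -> forall u, P u.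
Proof.
move=> P1 PD PZ Ps PV; apply: (@ga_ind K _ P) => [|u v|k g].
- by have := PZ 0 1 P1; rewrite kscal0 mul0r.
- exact: PD.
have -> : << k *g g >> = k%:S * ga_of K g by rewrite [RHS]ga_mulUU mulr1 mul1g.
apply: PZ; have [w ->] := pres_class_surj g; elim: w => [//|[[i hi] e] w IH].
rewrite -cat1s pres_classM ga_ofM; case: e.
  by have := Ps i _ hi IH; rewrite /sB (artinE hi).
have := PV i _ hi IH; rewrite /sBV (artinE hi).
by rewrite [_^-1%g]pres_invE.
Qed.
End BraidAlgebra.

Section BraidConjugation.
Variables (A : pzRingType) (n : nat) (s sV : nat -> A).
Hypothesis sK : forall i, s i * sV i = 1.
Hypothesis s_braid : forall i, (0 < i)%N -> (i.+1 < n)%N ->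
  s i * s i.+1 * s i = s i.+1 * s i * s i.+1.
Hypothesis s_far : forall i j, (0 < i)%N -> (i.+1 < j)%N -> (j < n)%N ->
  s i * s j = s j * s i.

(** The braid relation reads s_{i+1} (s_i s_{i+1}) = (s_i s_{i+1}) s_i, so s_i s_{i+1} intertwines
    neighbouring generators; [g] is a product of such factors. *)
Lemma braid_conj i : (0 < i < n)%N ->
  exists g h : A, g * h = 1 /\ s i * g = g * s 1.
Proof.
elim: i => [//|[_ _|i IH hi]]; first by exists 1, 1; rewrite !mulr1 mul1r.
have [|g [h [gh sg]]] := IH; first by lia.
have br := s_braid (isT : 0 < i.+1)%N hi.
exists (s i.+1 * s i.+2 * g), (h * (sV i.+2 * sV i.+1)); split.
  by rewrite -!mulrA (mulrA g) gh mul1r (mulrA (s i.+2)) sK mul1r sK.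
by rewrite !mulrA -br -!mulrA sg.
Qed.

(** The product s_i s_{i+1} s_{i+2} shifts the whole pair (s_i, s_{i+1}) to (s_{i+1}, s_{i+2}), so
    relations between s_1 and s_2 pass to every adjacent pair. *)
Lemma braid_conj2 i : (0 < i)%N -> (i.+1 < n)%N ->
  exists g h : A, [/\ g * h = 1, s i * g = g * s 1 & s i.+1 * g = g * s 2].
Proof.
elim: i => [//|[_ _ _|i IH _ hi]]; first by exists 1, 1; rewrite !mulr1 !mul1r.
have [||g [h [gh sg sg']]] := IH; [by []|by lia|].
have br := s_braid (isT : 0 < i.+1)%N (ltnW hi).
have br' := s_braid (isT : 0 < i.+2)%N hi.
have far := s_far (isT : 0 < i.+1)%N (ltnSn i.+2) hi.
exists (s i.+1 * s i.+2 * s i.+3 * g), (h * (sV i.+3 * (sV i.+2 * sV i.+1)));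
  split.
- rewrite -!mulrA (mulrA g) gh mul1r (mulrA (s i.+3)) sK mul1r.
  by rewrite (mulrA (s i.+2)) sK mul1r sK.
- by rewrite !mulrA -br -(mulrA _ (s i.+1)) far -!mulrA sg.
- by rewrite !mulrA -far -!(mulrA (s i.+1)) -br' -!mulrA sg'.
Qed.
End BraidConjugation.

Section Intertwiner.
Variables (K : fieldType) (B : kalgType K) (g h : B).
Hypothesis gh : g * h = 1.

Lemma intertwine_scal (u v : B) k w :
  u * g = g * v -> (u - k%:S) * (g * w) = g * ((v - k%:S) * w).
Proof. by move=> ug; rewrite mulrA mulrBl ug kscalC -mulrBr -mulrA. Qed.

Lemma intertwine_vanish2 (u v : B) x y : u * g = g * v ->
  (v - x%:S) * (v - y%:S) = 0 -> (u - x%:S) * (u - y%:S) = 0.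
Proof.
move=> ug v0; rewrite -[LHS]mulr1 -gh -mulrA !(intertwine_scal _ _ ug).
by rewrite (mulrA (v - _)) v0 mul0r mulr0.
Qed.

Lemma intertwine_vanish3 (u v : B) x y z : u * g = g * v ->
  (v - x%:S) * (v - y%:S) * (v - z%:S) = 0 ->
  (u - x%:S) * (u - y%:S) * (u - z%:S) = 0.
Proof.
move=> ug v0; rewrite -[LHS]mulr1 -gh -!mulrA !(intertwine_scal _ _ ug).
by rewrite (mulrA (v - _)) (mulrA (_ * _)) v0 mul0r mulr0.
Qed.

Lemma intertwine_cubic_pair (u v u' v' : B) : u * g = g * v -> u' * g = g * v'
  ->
  cubic_pair v v' -> cubic_pair u u'.
Proof.
move=> ug ug' [br b0].
have U w : u * (g * w) = g * (v * w) by rewrite mulrA ug mulrA.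
have U' w : u' * (g * w) = g * (v' * w) by rewrite mulrA ug' mulrA.
split; apply/eqP; rewrite -subr_eq0 ?subr0; apply/eqP.
  rewrite -[LHS]mulr1 -gh mulrBl -!mulrA !(U, U') -mulrBr -[RHS](mulr0 g).
  congr (_ * _); rewrite -[RHS](mul0r h) -[in RHS](subrr (v * v' * v)) {2}br.
  by nc_ring (@nil K) [:: v; v'; h].
rewrite -[LHS]mulr1 -gh mulrDl !mulrBl !expr2 -!mulrA !(U, U') -!mulrBr -mulrDr.
rewrite -[RHS](mulr0 g); congr (_ * _); rewrite -[RHS](mul0r h) -[in RHS]b0.
by nc_ring (@nil K) [:: v; v'; h].
Qed.
End Intertwiner.

Section BraidQuotient.
Variables (K : fieldType) (a b c : K) (n : nat) (B : kalgType K).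
Variables t tV : nat -> B.
Hypothesis tK : forall i, t i * tV i = 1.
Hypothesis t_braid : forall i, (0 < i)%N -> (i.+1 < n)%N ->
  t i * t i.+1 * t i = t i.+1 * t i * t i.+1.
Hypothesis t_far : forall i j, (0 < i)%N -> (i.+1 < j)%N -> (j < n)%N ->
  t i * t j = t j * t i.

Lemma braid_vanish2 x y i : (0 < i < n)%N ->
  (t 1 - x%:S) * (t 1 - y%:S) = 0 -> (t i - x%:S) * (t i - y%:S) = 0.
Proof.
move=> hi; have [g [h [gh tg]]] := braid_conj tK t_braid hi.
exact: (intertwine_vanish2 gh tg).
Qed.

Lemma braid_vanish3 x y z i : (0 < i < n)%N ->
  (t 1 - x%:S) * (t 1 - y%:S) * (t 1 - z%:S) = 0 ->
  (t i - x%:S) * (t i - y%:S) * (t i - z%:S) = 0.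
Proof.
move=> hi; have [g [h [gh tg]]] := braid_conj tK t_braid hi.
exact: (intertwine_vanish3 gh tg).
Qed.

Lemma braid_cubic_pair i : (0 < i)%N -> (i.+1 < n)%N ->
  t 2 ^+ 2 * t 1 - t 1 * t 2 ^+ 2 - t 2 * t 1 ^+ 2 + t 1 ^+ 2 * t 2 = 0 ->
  cubic_pair (t i) (t i.+1).
Proof.
move=> i0 iSn b0.
have [g [h [gh tg tg']]] := braid_conj2 tK t_braid t_far i0 iSn.
apply: (intertwine_cubic_pair gh tg tg'); split=> //; apply: t_braid => //.
by lia.
Qed.

Hypothesis abc : (a - b) * (a - c) * (b - c) != 0.
Hypothesis abc0 : [/\ a != 0, b != 0 & c != 0].
Hypothesis t_cubic : (t 1 - a%:S) * (t 1 - b%:S) * (t 1 - c%:S) = 0.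

Lemma inverse_cubic i : (0 < i < n)%N ->
  tV i = (a * b * c)^-1%:S
    * (t i * t i - (a + b + c)%:S * t i + (a * b + b * c + a * c)%:S).
Proof.
move=> hi; have abcU : a * b * c != 0 by case: abc0 => *; rewrite !mulf_neq0.
rewrite -[LHS](kscalMK _ (mulVf abcU)); congr (_ * _).
have t3 : (a * b * c)%:S
    = t i * t i * t i - (a + b + c)%:S * (t i * t i) + (a * b + b * c + a *
      c)%:S * t i.
  apply/eqP; rewrite eq_sym -subr_eq0 -(braid_vanish3 hi t_cubic); apply/eqP.
  by nc_ring [:: a; b; c] [:: t i].
by rewrite t3 mulrDl mulrBl -!mulrA tK !mulr1.
Qed.

Hypothesis B_ind : forall P : B -> Prop, P 1 ->
  (forall u v, P u -> P v -> P (u + v)) -> (forall k u, P u -> P (k%:S * u)) ->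
  (forall i u, (0 < i < n)%N -> P u -> P (t i * u)) ->
  (forall i u, (0 < i < n)%N -> P u -> P (tV i * u)) -> forall u, P u.

(** The cubic relation has the nonzero constant term a b c, so by [inverse_cubic] inverse generators
    are polynomials in the generators, and positive words span. *)
Lemma positive_ind (P : B -> Prop) : P 1 ->
  (forall u v, P u -> P v -> P (u + v)) -> (forall k u, P u -> P (k%:S * u)) ->
  (forall i u, (0 < i < n)%N -> P u -> P (t i * u)) -> forall u, P u.
Proof.
move=> P1 PD PZ Pt; apply: B_ind => // i u hi Pu;
  rewrite inverse_cubic // -[_ * _ * u]mulrA.
apply: (PZ); rewrite -mulNr -kscalN !mulrDl -!mulrA.
apply: (PD); last exact: PZ.
by apply: (PD); [apply: (Pt) => //; exact: Pt|apply: (PZ); exact: Pt].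
Qed.

Lemma prime_quadratic : (1 < n <= 4)%N ->
  (forall u v : B, (forall w, u * w * v = 0) -> u = 0 \/ v = 0) ->
  ((2 < n)%N ->
    t 2 ^+ 2 * t 1 - t 1 * t 2 ^+ 2 - t 2 * t 1 ^+ 2 + t 1 ^+ 2 * t 2 = 0) ->
  [\/ (t 1 - a%:S) * (t 1 - b%:S) = 0, (t 1 - a%:S) * (t 1 - c%:S) = 0
    | (t 1 - b%:S) * (t 1 - c%:S) = 0].
Proof.
case/andP=> n1 n4 B_prime b0.
have lam_inj := lam3_inj abc.
have lam_neq0 x : lam3 a b c x != 0.
  by case: abc0; case: x => [[|[|[|//]]] ?].
have /choice[e se] i : exists ei,
  (0 < i < n)%N -> spectral (lam3 a b c) (t i) ei.
  case: (boolP (0 < i < n)%N) => [hi|_]; last by exists (fun=> 0).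
  by have [e se] := cubic_spectral abc (braid_vanish3 hi t_cubic); exists e.
have tv := triple_vanish lam_inj lam_neq0 n4 se.
have [x ex] : exists x, e 1 x = 0.
  apply: (prime_missing_eigenvalue n1 se _ positive_ind B_prime).
  move=> i j k x y z; apply: tv => // l l0 ln.
  by apply: braid_cubic_pair => //; apply: b0; lia.
have q y z : uniq [:: x; y; z] ->
    (t 1 - (lam3 a b c y)%:S) * (t 1 - (lam3 a b c z)%:S) = 0.
  by move=> xyz; exact: (missing_eigenvalue_quadratic (se 1 n1) xyz ex).
move: q; case: x {ex} => [[|[|[|//]]] hx] q.
- by apply: Or33; exact: (q (@Ordinal 3 1 isT) (@Ordinal 3 2 isT)).
- by apply: Or32; exact: (q (@Ordinal 3 0 isT) (@Ordinal 3 2 isT)).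
- by apply: Or31; exact: (q (@Ordinal 3 0 isT) (@Ordinal 3 1 isT)).
Qed.
End BraidQuotient.

(** * Quotients and split semisimple algebras *)

Section Quotients.
Variables (K : pzRingType) (A : kalgType K).

Lemma quo_proj_eq0 (I : ideal A) x : quo_proj I x = 0 <-> I x.
Proof. by rewrite -[x in I x]subr0; exact: quoP. Qed.

Lemma quo_proj_alg (I : ideal A) : alg_morphism (quo_proj I).
Proof. by []. Qed.

Lemma gen_ideal_sub (S : set A) x : S x -> gen_ideal S x.
Proof. by move=> Sx J [_]; exact. Qed.

Lemma gen_ideal_ker (S : set A) (B : pzRingType) (g : {rmorphism A -> B}) :
  (forall x, S x -> g x = 0) -> forall x, gen_ideal S x -> g x = 0.
Proof.
move=> gS x /(_ [set y | g y = 0]%classic); apply; split=> [|y Sy];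
  last exact: gS.
split=> [|y z gy gz|y z w gz]; rewrite /mkset ?rmorph0 //.
  by rewrite rmorphD gy gz addr0.
by rewrite !rmorphM gz mulr0 mul0r.
Qed.

Lemma quo_lift (I : ideal A) (B : kalgType K) (g : {rmorphism A -> B}) :
  alg_morphism g -> (forall x, I x -> g x = 0) ->
  exists h : {rmorphism quo I -> B},
    alg_morphism h /\ forall x, h (quo_proj I x) = g x.
Proof.
move=> g_alg gI; pose h (u : quo I) : B := g (repr u).
have hE x : h (quo_proj I x) = g x.
  by apply/eqP; rewrite -subr_eq0 -rmorphB; apply/eqP/gI/quo_repr.
have hB : zmod_morphism h.
  move=> u v; have [x ->] := quo_proj_surj u; have [y ->] := quo_proj_surj v.
  by rewrite -rmorphB !hE rmorphB.
have hM : monoid_morphism h.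
  split=> [|u v]; first by rewrite -(rmorph1 (quo_proj I)) hE rmorph1.
  have [x ->] := quo_proj_surj u; have [y ->] := quo_proj_surj v.
  by rewrite -rmorphM !hE rmorphM.
pose hM' : {rmorphism quo I -> B} :=
  HB.pack h (GRing.isZmodMorphism.Build _ _ h hB)
    (GRing.isMonoidMorphism.Build _ _ h hM).
by exists hM'; split=> // k; rewrite -g_alg -hE.
Qed.
End Quotients.

Lemma delta_mx_mul_delta (R : pzRingType) m n p q (y : 'M[R]_(n, p)) i j k l :
  delta_mx i j *m y *m delta_mx k l = y j k *: delta_mx i l :> 'M[R]_(m, q).
Proof.
apply/matrixP => i' l'; rewrite !mxE (bigD1 k) //= big1 => [|k' /negPf k'k].
  rewrite !mxE eqxx addr0 (bigD1 j) //= big1 => [|j' /negPf j'j].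
    rewrite !mxE eqxx andbT addr0.
    by case: eqP; rewrite ?mul1r ?mul0r //= mulr0.
  by rewrite mxE j'j andbF mul0r.
by rewrite [delta_mx k l _ _]mxE k'k mulr0.
Qed.

Section SplitSemisimple.
Variables (K : fieldType) (A : kalgType K) (r : nat) (d : 'I_r -> nat).
Variable f : forall i, {rmorphism A -> 'M[K]_((d i).+1)}.
Hypothesis f_bij : forall y : forall i, 'M[K]_((d i).+1),
  exists! x : A, forall i, f i x = y i.

Lemma component_inj x y : (forall i, f i x = f i y) -> x = y.
Proof.
move=> xy; have [z [_ zu]] := f_bij (fun i => f i y).
by rewrite -(zu x xy) -(zu y).
Qed.

Lemma component_lift i (m : 'M[K]_((d i).+1)) :
  exists2 x, f i x = m & forall j, j != i -> f j x = 0.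
Proof.
have [x [xE _]] := f_bij (dfwith (fun=> 0) m).
by exists x => [|j ji]; rewrite xE ?dfwith_in // dfwith_out // eq_sym.
Qed.

(** Simplicity of a matrix algebra made explicit: if y_kl is nonzero, the sum over m of E_mk y E_lm
    divided by y_kl is 1. The lifts [p m] and [q m] vanish on the other factors, so the result is
    the central idempotent of factor [i]. *)
Lemma ideal_component i (I : ideal A) y : I y -> f i y <> 0 ->
  exists2 u, I u & f i u = 1 /\ forall j, j != i -> f j u = 0.
Proof.
have [I0 ID IM] := idealP I; move=> Iy fy.
have [k [l ykl]] : exists k l, f i y k l != 0.
  apply: contrapT => none; apply: fy; apply/matrixP => k l; rewrite mxE.
  by apply/eqP/negPn/negP => ykl; apply: none; exists k, l.
have /choice[p pE] m : exists p, f i p = delta_mx m k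
    /\ forall j, j != i -> f j p = 0.
  by have [p p1 p2] := component_lift (delta_mx m k : 'M_((d i).+1)); exists p.
have /choice[q qE] m : exists q, f i q = (f i y k l)^-1 *: delta_mx l m
    /\ forall j, j != i -> f j q = 0.
  by have [q q1 q2] := component_lift ((f i y k l)^-1 *: delta_mx l m : 'M_((d
    i).+1)); exists q.
exists (\sum_m p m * y * q m).
  by elim/big_ind: _ => // m _; exact: IM.
split=> [|j ji]; rewrite rmorph_sum /=; last first.
  by rewrite big1 // => m _; rewrite !rmorphM (proj2 (pE m)) ?mul0r.
rewrite (eq_bigr (fun m => delta_mx m m)) => [|m _].
  by rewrite -mx1_sum_delta.
rewrite !rmorphM (proj1 (pE m)) (proj1 (qE m)) -!mulmxE -scalemxAr.
by rewrite delta_mx_mul_delta scalerA mulVf // scale1r.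
Qed.

(** With u_i mapping to 1 in factor [i] and to 0 elsewhere, [x] is the sum of the x u_i. Each of
    these is zero or a multiple of a central idempotent that lies in the ideal by
    [ideal_component]. *)
Lemma semisimple_mem (I : ideal A) x :
  (forall i, f i x <> 0 -> exists2 y, I y & f i y <> 0) -> I x.
Proof.
move=> xI; have [I0 ID IM] := idealP I.
have /choice[u uE] i : exists u, I (x * u) /\ f i u = 1
    /\ forall j, j != i -> f j u = 0.
  have [fx|fx] := pselect (f i x = 0).
    have [u u1 u0] := component_lift (1 : 'M[K]_((d i).+1)).
    exists u; split=> //; suff -> : x * u = 0 by [].
    apply: component_inj => j; rewrite rmorphM rmorph0.
    by have [->|ji] := eqVneq j i; rewrite ?fx ?mul0r // u0 ?mulr0.
  have [y Iy fy] := xI i fx; have [u Iu [u1 u0]] := ideal_component Iy fy.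
  exists u; split=> //; rewrite -[x * u]mulr1; exact: IM.
have -> : x = \sum_i x * u i.
  apply: component_inj => j; rewrite rmorph_sum (bigD1 j) //= big1 => [|i ij].
    by rewrite addr0 rmorphM (proj1 (proj2 (uE j))) mulr1.
  by rewrite rmorphM (proj2 (proj2 (uE i))) ?mulr0 // eq_sym.
by elim/big_ind: _ => // i _; case: (uE i).
Qed.
End SplitSemisimple.

Lemma matrix_prime (K : fieldType) d (u v : 'M[K]_d.+1) :
  (forall w, u * w * v = 0) -> u = 0 \/ v = 0.
Proof.
move=> uv; have [->|v0] := eqVneq v 0; first by right.
left; apply/matrixP => i j; rewrite mxE.
have [k [l vkl]] : exists k l, v k l != 0.
  apply: contrapT => none; case/eqP: v0; apply/matrixP => k l; rewrite mxE.
  by apply/eqP/negPn/negP => vkl; apply: none; exists k, l.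
(* Taking w = E_jk and multiplying by E_ii and E_ll on the two sides reads off u_ij v_kl = 0. *)
have := congr1 (fun w => delta_mx i i *m w *m delta_mx l l) (uv (delta_mx j k)).
rewrite -!mulmxE !mulmxA delta_mx_mul_delta -!scalemxAl delta_mx_mul_delta.
rewrite mulmx0 mul0mx scalerA => /matrixP/(_ i l)/eqP.
by rewrite !mxE !eqxx mulr1 mulf_eq0 (negPf vkl) orbF => /eqP.
Qed.

(** * The isomorphism *)

Section BraidImage.
Variables (K : fieldType) (n : nat) (B : kalgType K).
Variable F : {rmorphism KB K n -> B}.
Hypothesis F_alg : alg_morphism F.

Lemma image_sBK i : F (sB K n i) * F (sBV K n i) = 1.
Proof. by rewrite -rmorphM sBK rmorph1. Qed.

Lemma image_sB_braid i : (0 < i)%N -> (i.+1 < n)%N ->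
  F (sB K n i) * F (sB K n i.+1) * F (sB K n i)
    = F (sB K n i.+1) * F (sB K n i) * F (sB K n i.+1).
Proof. by move=> i0 iSn; have /(congr1 F) := sB_braid K i0 iSn;
  rewrite !(rmorphM F). Qed.

Lemma image_sB_far i j : (0 < i)%N -> (i.+1 < j)%N -> (j < n)%N ->
  F (sB K n i) * F (sB K n j) = F (sB K n j) * F (sB K n i).
Proof. by move=> i0 ij jn; have /(congr1 F) := sB_far K i0 ij jn;
  rewrite !(rmorphM F). Qed.

Lemma image_ind (P : B -> Prop) : (forall u, exists x, u = F x) -> P 1 ->
  (forall u v, P u -> P v -> P (u + v)) -> (forall k u, P u -> P (k%:S * u)) ->
  (forall i u, (0 < i < n)%N -> P u -> P (F (sB K n i) * u)) ->
  (forall i u, (0 < i < n)%N -> P u -> P (F (sBV K n i) * u)) -> forall u, P u.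
Proof.
move=> F_surj P1 PD PZ Ps PV u; have [x ->] := F_surj u.
elim/KB_ind: x => [|x y|k x|i x hi|i x hi].
- by rewrite rmorph1.
- by rewrite rmorphD; exact: PD.
- by rewrite rmorphM F_alg; exact: PZ.
- by rewrite rmorphM; exact: Ps.
- by rewrite rmorphM; exact: PV.
Qed.
End BraidImage.


(** In the combination of quadratic expressions with the shape of b, the linear and constant terms
    cancel, so b lies in the ideal of the two quadratic relations. *)
Lemma quadratic_b (K : fieldType) (B : kalgType K) (x y : K) (s t : B) :
  (s - x%:S) * (s - y%:S) = 0 -> (t - x%:S) * (t - y%:S) = 0 ->
  t ^+ 2 * s - s * t ^+ 2 - t * s ^+ 2 + s ^+ 2 * t = 0.
Proof.
move=> s0 t0.
transitivity ((t - x%:S) * (t - y%:S) * s - s * ((t - x%:S) * (t - y%:S))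
  - t * ((s - x%:S) * (s - y%:S)) + (s - x%:S) * (s - y%:S) * t).
  by nc_ring [:: x; y] [:: s; t].
by rewrite s0 t0 !(mulr0, mul0r) !subr0 addr0.
Qed.

Lemma quadratic_cubic (K : fieldType) (B : kalgType K) (a b c x y : K) (s : B) :
  (x, y) \in [:: (a, b); (a, c); (b, c)] -> (s - x%:S) * (s - y%:S) = 0 ->
  (s - a%:S) * (s - b%:S) * (s - c%:S) = 0.
Proof.
rewrite !inE => /or3P[] /eqP[-> ->] s0; first by rewrite s0 mul0r.
  transitivity ((s - a%:S) * (s - c%:S) * (s - b%:S)).
    by nc_ring [:: a; b; c] [:: s].
  by rewrite s0 mul0r.
by rewrite -mulrA s0 mulr0.
Qed.

Lemma alg_morphism_quadratic (K : pzRingType) (A B : kalgType K)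
    (F : {rmorphism A -> B}) x y u : alg_morphism F ->
  F ((u - x%:S) * (u - y%:S)) = (F u - x%:S) * (F u - y%:S).
Proof. by move=> F_alg; rewrite rmorphM !rmorphB !F_alg. Qed.

Lemma alg_morphism_cubic (K : pzRingType) (A B : kalgType K)
    (F : {rmorphism A -> B}) x y z u : alg_morphism F ->
  F ((u - x%:S) * (u - y%:S) * (u - z%:S))
    = (F u - x%:S) * (F u - y%:S) * (F u - z%:S).
Proof. by move=> F_alg; rewrite !rmorphM !rmorphB !F_alg. Qed.

Lemma rmorph_b (A B : pzRingType) (F : {rmorphism A -> B}) s t :
  F (t ^+ 2 * s - s * t ^+ 2 - t * s ^+ 2 + s ^+ 2 * t)
    = F t ^+ 2 * F s - F s * F t ^+ 2 - F t * F s ^+ 2 + F s ^+ 2 * F t.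
Proof. by rewrite !(rmorphD, rmorphN, rmorphM). Qed.

Section CubicQuotients.
Variables (K : fieldType) (n : nat) (a b c : K).
Hypothesis n_gt1 : (1 < n)%N.
Local Notation KB := (KB K n).
Local Notation s := (sB K n).

Definition to_calK : {rmorphism KB -> calK n a b c} :=
  quo_proj (b_ideal n a b c) \o quo_proj (cubic_ideal n a b c).

Lemma to_calK_surj (u : calK n a b c) : exists x, u = to_calK x.
Proof.
by have [v ->] := quo_proj_surj u; have [x ->] := quo_proj_surj v; exists x.
Qed.

Lemma calK_lift (B : kalgType K) (F : {rmorphism KB -> B}) (t : nat -> B) :
  alg_morphism F -> (forall i, F (s i) = t i) ->
  (t 1 - a%:S) * (t 1 - b%:S) * (t 1 - c%:S) = 0 ->
  ((2 < n)%N -> t 2 ^+ 2 * t 1 - t 1 * t 2 ^+ 2 - t 2 * t 1 ^+ 2 + t 1 ^+ 2 * t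
    2 = 0) ->
  exists h : {rmorphism calK n a b c -> B},
    alg_morphism h /\ forall x, h (to_calK x) = F x.
Proof.
move=> F_alg tE cub b0.
have [h1 [h1_alg h1E]] : exists h : {rmorphism Hn n a b c -> B},
    alg_morphism h /\ forall x, h (quo_proj _ x) = F x.
  apply: quo_lift => //; apply: gen_ideal_ker => _ ->.
  by apply: etrans (alg_morphism_cubic _ _ _ _ F_alg) _; rewrite (tE 1).
have [h [h_alg hE]] : exists h : {rmorphism calK n a b c -> B},
    alg_morphism h /\ forall x, h (quo_proj _ x) = h1 x.
  apply: quo_lift => //; apply: gen_ideal_ker => _ [n2 ->].
  rewrite /bH; set s1 := sH n a b c 1; set s2 := sH n a b c 2.
  have hs1 : h1 s1 = t 1 by rewrite -tE -h1E.
  have hs2 : h1 s2 = t 2 by rewrite -tE -h1E.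
  move: s1 s2 hs1 hs2 => s1 s2 hs1 hs2.
  by rewrite rmorph_b hs1 hs2 b0.
by exists h; split=> // x; rewrite -h1E -hE.
Qed.

Lemma Jn_quadratic x y i : (0 < i < n)%N ->
  (quo_proj (Jn n x y) (s i) - x%:S) * (quo_proj (Jn n x y) (s i) - y%:S) = 0.
Proof.
move=> hi; have F_alg := @quo_proj_alg _ _ (Jn n x y).
apply: (@braid_vanish2 _ n _ (fun i => quo_proj (Jn n x y) (s i)) _
  (image_sBK _) (image_sB_braid _)) => //.
apply: etrans (esym (alg_morphism_quadratic x y (s 1) F_alg)) _.
by apply/quo_proj_eq0; exact: gen_ideal_sub.
Qed.

(** A quotient by an intersection embeds in the product of the quotients by the J_n(x, y), in each
    of which all generators satisfy one common quadratic relation. *)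
Lemma calH_ext (u v : calH n a b c) :
  (forall (B : kalgType K) (k : {rmorphism calH n a b c -> B}) x y,
    (x, y) \in [:: (a, b); (a, c); (b, c)] -> alg_morphism k ->
    (forall i, (0 < i < n)%N ->
      (k (sHH n a b c i) - x%:S) * (k (sHH n a b c i) - y%:S) = 0) ->
    k u = k v) -> u = v.
Proof.
move=> kuv; have [x0 uE] := quo_proj_surj u; have [y0 vE] := quo_proj_surj v.
have inJ x y : (x, y) \in [:: (a, b); (a, c); (b, c)] -> Jn n x y (x0 - y0).
  move=> xy; have [k [k_alg kE]] : exists k : {rmorphism calH n a b c -> quo
    (Jn n x y)},
    alg_morphism k /\ forall z, k (quo_proj (Jcap n a b c) z) = quo_proj (Jn n
      x y) z.
    apply: quo_lift => // z [[]] Jab Jac Jbc; apply/quo_proj_eq0.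
    move: xy; rewrite !inE => /or3P[] /eqP[-> ->];
      [exact: Jab|exact: Jac|exact: Jbc].
  apply/quoP; rewrite -!kE -uE -vE; apply: kuv xy k_alg _ => i hi.
  by rewrite kE; exact: Jn_quadratic.
rewrite uE vE; apply/quoP.
by split; [split|]; apply: inJ; rewrite !inE eqxx ?orbT.
Qed.

Lemma calK_to_calH :
  exists f : {rmorphism calK n a b c -> calH n a b c},
    alg_morphism f /\ forall u, f (to_calK u) = quo_proj (Jcap n a b c) u.
Proof.
apply: (@calK_lift _ _ (sHH n a b c)) => //.
  apply: calH_ext => B k x y xy k_alg kS.
  rewrite alg_morphism_cubic // rmorph0.
  by apply: quadratic_cubic xy (kS 1 _); rewrite n_gt1.
move=> n2; apply: calH_ext => B k x y xy k_alg kS.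
apply: etrans (rmorph_b k _ _) (etrans _ (esym (rmorph0 k))).
by apply: (quadratic_b (kS 1 _) (kS 2 _)); lia.
Qed.
End CubicQuotients.


Section JcapVanish.
Variables (K : fieldType) (n : nat) (a b c : K).
Local Notation KB := (KB K n).
Local Notation s := (sB K n).
Hypothesis abc : (a - b) * (a - c) * (b - c) != 0.
Hypothesis abc0 : [/\ a != 0, b != 0 & c != 0].

Lemma Hn_cubic : (sH n a b c 1 - a%:S) * (sH n a b c 1 - b%:S) * (sH n a b c 1
  - c%:S) = 0.
Proof.
apply: etrans (esym (alg_morphism_cubic a b c (s 1) (@quo_proj_alg _ _
  (cubic_ideal n a b c)))) _.
by apply/quo_proj_eq0; exact: gen_ideal_sub.
Qed.

Section PrimeFactor.
Variables (B : kalgType K) (f : {rmorphism Hn n a b c -> B}).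
Hypotheses (n14 : (1 < n <= 4)%N) (f_alg : alg_morphism f).
Hypothesis f_surj : forall m, exists u, m = f u.
Hypothesis B_prime : forall u v : B, (forall w,
  u * w * v = 0) -> u = 0 \/ v = 0.
Hypothesis fb : (2 < n)%N -> f (bH n a b c) = 0.

Lemma prime_factor_quadratic : exists x y,
  (x, y) \in [:: (a, b); (a, c); (b, c)] /\
  (f (sH n a b c 1) - x%:S) * (f (sH n a b c 1) - y%:S) = 0.
Proof.
pose F := f \o quo_proj (cubic_ideal n a b c) : {rmorphism KB -> B}.
have F_alg : alg_morphism F by exact: f_alg.
have F_surj u : exists x, u = F x.
  by have [v ->] := f_surj u; have [y ->] := quo_proj_surj v; exists y.
pose t i := f (sH n a b c i).
have t_cubic : (t 1 - a%:S) * (t 1 - b%:S) * (t 1 - c%:S) = 0.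
  by rewrite -alg_morphism_cubic // Hn_cubic rmorph0.
have t_b : (2 < n)%N ->
    t 2 ^+ 2 * t 1 - t 1 * t 2 ^+ 2 - t 2 * t 1 ^+ 2 + t 1 ^+ 2 * t 2 = 0.
  by move=> n2; rewrite -rmorph_b; exact: fb.
have [t0|t0|t0] := prime_quadratic (image_sBK F) (image_sB_braid F)
  (image_sB_far F) abc abc0 t_cubic (fun P => @image_ind _ _ _ _ F_alg P F_surj)
  n14 B_prime t_b.
- by exists a, b; rewrite !inE eqxx.
- by exists a, c; rewrite !inE eqxx orbT.
- by exists b, c; rewrite !inE eqxx !orbT.
Qed.

Lemma prime_factor_kills_Jcap x :
  Jcap n a b c x -> f (quo_proj (cubic_ideal n a b c) x) = 0.
Proof.
move=> [[Jab Jac] Jbc]; pose F := f \o quo_proj (cubic_ideal n a b c) :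
  {rmorphism KB -> B}.
have F_alg : alg_morphism F by exact: f_alg.
have kill y z : (f (sH n a b c 1) - y%:S) * (f (sH n a b c 1) - z%:S) = 0 ->
    Jn n y z x -> F x = 0.
  move=> t0; apply: gen_ideal_ker => _ ->.
  by apply: etrans (alg_morphism_quadratic _ _ _ F_alg) t0.
have [y [z [yz t0]]] := prime_factor_quadratic.
move: yz t0; rewrite !inE => /or3P[] /eqP[-> ->] t0.
- exact: kill t0 Jab.
- exact: kill t0 Jac.
- exact: kill t0 Jbc.
Qed.
End PrimeFactor.

(** By [semisimple_mem] only factors on which the ideal of b vanishes need attention; such a factor
    is quadratic, so it kills one J_n(x, y) and with it the intersection. *)
Lemma Jcap_b_ideal x : (1 < n <= 4)%N -> split_semisimple (Hn n a b c) ->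
  Jcap n a b c x -> b_ideal n a b c (quo_proj (cubic_ideal n a b c) x).
Proof.
move=> n14 [r [d [f [f_alg f_bij]]]] Jx.
apply: (semisimple_mem f_bij) => i fx; apply: contrapT => none; apply: fx.
apply: prime_factor_kills_Jcap => //.
- by move=> m; have [u <- _] := component_lift f_bij m; exists u.
- exact: matrix_prime.
- move=> n2; apply: contrapT => fb; apply: none; exists (bH n a b c) => //.
  exact: gen_ideal_sub.
Qed.

(** H_2 is commutative, being generated by s_1, so the projections of s_1 are central. The one for w
    kills the image of J(y, z) when w is y or z, and the three projections add up to 1. *)
Lemma commutative_kills_Jcap x : n = 2 -> Jcap n a b c x ->
  quo_proj (cubic_ideal n a b c) x = 0.
Proof.
move=> n2 [[Jab Jac] Jbc].
pose F := quo_proj (cubic_ideal n a b c) : {rmorphism KB -> Hn n a b c}.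
pose t := sH n a b c 1.
have F_alg : alg_morphism F by [].
have F_surj u : exists x, u = F x by exact: quo_proj_surj.
have t_comm u : t * u = u * t.
  move: u; apply: (positive_ind (image_sBK F) (image_sB_braid F) abc0 Hn_cubic
    (fun P => @image_ind _ _ _ _ F_alg P F_surj)).
  - by rewrite mulr1 mul1r.
  - by move=> u v tu tv; rewrite mulrDr mulrDl tu tv.
  - by move=> k u tu; rewrite kscalCA tu mulrA.
  - move=> i u hi tu; have -> : i = 1%N by lia.
    by rewrite -/t -mulrA -tu.
have [e te] := cubic_spectral abc Hn_cubic.
have [_ e1 eS] := te; have lam_inj := lam3_inj abc.
have e_comm w u : e w * u = u * e w by exact: (spectral_comm lam_inj w te
  (t_comm u)).
have kill w y z : (lam3 a b c w - y) * (lam3 a b c w - z) = 0 -> Jn n y z x ->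
    e w * F x = 0.
  move=> wyz /(_ [set u | e w * F u = 0]%classic); apply; split.
    split=> [|u v|u v u']; rewrite /mkset ?rmorph0 ?mulr0 //.
      by rewrite rmorphD mulrDr => -> ->; rewrite addr0.
    move=> v0; transitivity (F u * (e w * F v) * F u'); last first.
      by rewrite v0 mulr0 mul0r.
    by rewrite !rmorphM !mulrA e_comm.
  move=> _ ->; rewrite /mkset -/F.
  have -> := alg_morphism_quadratic y z (s 1) F_alg.
  have eB k : e w * (t - k%:S) = (lam3 a b c w - k)%:S * e w.
    by rewrite mulrBr (spectralV te) -kscalC kscalB mulrBl.
  by rewrite mulrA eB -mulrA eB mulrA -kscalM wyz kscal0 mul0r.
rewrite -[LHS]mul1r -e1 mulr_suml big1 // => w _.
by case: w => [[|[|[|//]]] ?]; [apply: kill Jab|apply: kill Jab|apply: kill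
  Jac];
  rewrite /lam3 /= subrr ?mul0r ?mulr0.
Qed.

(** Genericity speaks of H_3 and H_4; the case n = 2 is settled by commutativity instead. Both maps
    are induced by the identity of [KB], hence mutually inverse. *)
Lemma calK_iso : (1 < n <= 4)%N -> (n = 2 \/ split_semisimple (Hn n a b c)) ->
  exists f : {rmorphism calK n a b c -> calH n a b c},
    [/\ alg_morphism f,
        forall i : nat, (0 < i < n)%N -> f (sK n a b c i) = sHH n a b c i
      & bijective f].
Proof.
move=> n14 n_ss; have n1 : (1 < n)%N by lia.
have [f [f_alg fE]] := calK_to_calH a b c n1.
have [g [g_alg gE]] : exists g : {rmorphism calH n a b c -> calK n a b c},
    alg_morphism g /\ forall u, g (quo_proj (Jcap n a b c) u) = to_calK n a b c
      u.
  apply: quo_lift => // x Jx; case: n_ss => [n2|ss].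
    by rewrite /= commutative_kills_Jcap ?rmorph0.
  by apply/quo_proj_eq0; exact: Jcap_b_ideal.
exists f; split=> //; first by move=> i _; exact: fE.
exists g => u.
  by have [x ->] := to_calK_surj u; rewrite fE gE.
by have [x ->] := quo_proj_surj u; rewrite gE fE.
Qed.

Lemma calK_ext (u v : calK n a b c) : (1 < n <= 4)%N ->
  (n = 2 \/ split_semisimple (Hn n a b c)) ->
  (forall (B : kalgType K) (k : {rmorphism calK n a b c -> B}) x y,
    (x, y) \in [:: (a, b); (a, c); (b, c)] -> alg_morphism k ->
    (forall i, (0 < i < n)%N ->
      (k (sK n a b c i) - x%:S) * (k (sK n a b c i) - y%:S) = 0) ->
    k u = k v) -> u = v.
Proof.
move=> n14 n_ss kuv; have n1 : (1 < n)%N by lia.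
have [f [f_alg fs f_bij]] := calK_iso n14 n_ss.
apply: (bij_inj f_bij); apply: calH_ext => // B k x y xy k_alg kS.
apply: (kuv B (k \o f) x y xy) => [l|i hi] /=; first by rewrite f_alg.
by rewrite fs //; exact: kS.
Qed.
End JcapVanish.

(** * Relations checked in quadratic Hecke algebras *)

Section HeckeIdentities.
Variables (K : fieldType) (a b c : K) (A : kalgType K) (s1 s2 s3 : A).
Hypothesis A_ext : forall u v : A,
  (forall (B : kalgType K) (k : {rmorphism A -> B}) x y,
    (x, y) \in [:: (a, b); (a, c); (b, c)] -> alg_morphism k ->
    [/\ (k s1 - x%:S) * (k s1 - y%:S) = 0, (k s2 - x%:S) * (k s2 - y%:S) = 0
      & (k s3 - x%:S) * (k s3 - y%:S) = 0] -> k u = k v) -> u = v.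
Hypothesis s12 : s1 * s2 * s1 = s2 * s1 * s2.
Hypothesis s13 : s1 * s3 = s3 * s1.

Let S1 := a + b + c.
Let S2 := a * b + b * c + a * c.
Let S3 := a * b * c.

Lemma hecke_square (B : kalgType K) (t : B) x y :
  (t - x%:S) * (t - y%:S) = 0 -> t ^+ 2 = (x + y)%:S * t - (x * y)%:S.
Proof.
move=> t0; apply/eqP; rewrite -subr_eq0 -t0; apply/eqP.
by nc_ring [:: x; y] [:: t].
Qed.

(** Restates the test of equality with the images named and the quadratic relations oriented as
    rewriting rules for squares. *)
Lemma hecke_ext (u v : A) :
  (forall (B : kalgType K) (k : {rmorphism A -> B}) x y t1 t2 t3,
    (x, y) \in [:: (a, b); (a, c); (b, c)] -> alg_morphism k ->
    [/\ k s1 = t1, k s2 = t2 & k s3 = t3] ->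
    [/\ t1 ^+ 2 = (x + y)%:S * t1 - (x * y)%:S,
        t2 ^+ 2 = (x + y)%:S * t2 - (x * y)%:S
      & t3 ^+ 2 = (x + y)%:S * t3 - (x * y)%:S] ->
    t1 * t2 * t1 = t2 * t1 * t2 -> t1 * t3 = t3 * t1 ->
    k u = k v) -> u = v.
Proof.
move=> kuv; apply: A_ext => B k x y xy k_alg.
case=> /hecke_square q1 /hecke_square q2 /hecke_square q3.
by apply: (kuv _ _ _ _ _ _ _ xy) => //; rewrite -!rmorphM ?s12 ?s13.
Qed.

Lemma calK_rel_ii : s2 ^+ 2 * s1 = s2 * s1 ^+ 2 - s1 ^+ 2 * s2 + s1 * s2 ^+ 2.
Proof.
apply: hecke_ext => B k x y t1 t2 t3 xy k_alg [e1 e2 e3] [q1 q2 q3] br far.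
rewrite !(rmorphXn, rmorphD, rmorphN, rmorphM, k_alg, e1, e2, e3) q1 q2.
by nc_ring [:: x; y] [:: t1; t2].
Qed.

Lemma calK_rel_iii : s2 * s1 ^+ 2 * s2
  = - S3%:S * s1 + S2%:S * s1 * s2 + s1 * s2 * s1 ^+ 2
    - S1%:S * s1 * s2 ^+ 2 + s1 ^+ 2 * s2 ^+ 2.
Proof.
apply: hecke_ext => B k x y t1 t2 t3 xy k_alg [e1 e2 e3] [q1 q2 q3] br far.
rewrite !(rmorphXn, rmorphD, rmorphN, rmorphM, k_alg, e1, e2, e3) q1.
(* Eliminating the inner square of [t1] exposes [t2 * t1 * t2], to which the braid relation
   applies. *)
transitivity ((x + y)%:S * (t2 * t1 * t2) - (x * y)%:S * t2 ^+ 2).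
  by nc_ring [:: x; y] [:: t1; t2].
(* The coefficients involve the third eigenvalue as well, so each pair is checked separately. *)
rewrite -br q2; move: xy; rewrite !inE => /or3P[] /eqP[-> ->];
  nc_ring [:: a; b; c] [:: t1; t2].
Qed.

Lemma calK_rel_iv : s2 * s3 ^+ 2
  = - s1 ^+ 2 * s3 + s1 ^+ 2 * s2 + s2 ^+ 2 * s3 - s1 * s2 ^+ 2 + s1 * s3 ^+ 2.
Proof.
apply: hecke_ext => B k x y t1 t2 t3 xy k_alg [e1 e2 e3] [q1 q2 q3] br far.
rewrite !(rmorphXn, rmorphD, rmorphN, rmorphM, k_alg, e1, e2, e3) q1 q2 q3.
by nc_ring [:: x; y] [:: t1; t2; t3].
Qed.

Lemma calK_rel_v : s2 ^+ 2 * s3 * s1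
  = s2 * s1 ^+ 2 * s3 - s1 ^+ 2 * s2 * s3 + s1 * s2 ^+ 2 * s3.
Proof.
apply: hecke_ext => B k x y t1 t2 t3 xy k_alg [e1 e2 e3] [q1 q2 q3] br far.
rewrite !(rmorphXn, rmorphD, rmorphN, rmorphM, k_alg, e1, e2,
  e3) -mulrA -far q1 q2.
by nc_ring [:: x; y] [:: t1; t2; t3].
Qed.

Lemma calK_rel_vi : s2 ^+ 2 * s3 ^+ 2
  = - S3%:S * s1 + S2%:S * s1 * s3 - S1%:S * s1 ^+ 2 * s3
    + S3%:S * s2 - S2%:S * s2 * s3 + S1%:S * s1 ^+ 2 * s2
    - s1 ^+ 2 * s2 * s3 + S1%:S * s2 ^+ 2 * s3
    - S1%:S * s1 * s2 ^+ 2 + s1 * s2 ^+ 2 * s3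
    + s1 ^+ 2 * s3 ^+ 2.
Proof.
apply: hecke_ext => B k x y t1 t2 t3 xy k_alg [e1 e2 e3] [q1 q2 q3] br far.
rewrite !(rmorphXn, rmorphD, rmorphN, rmorphM, k_alg, e1, e2, e3) q1 q2 q3.
by move: xy; rewrite !inE => /or3P[] /eqP[-> ->];
  nc_ring [:: a; b; c] [:: t1; t2; t3].
Qed.

Lemma calK_rel_vii : s2 ^+ 2 * s3 ^+ 2
  = - S3%:S * s1 + S2%:S * s1 * s3 - S1%:S * s1 ^+ 2 * s3
    + S3%:S * s2 - S2%:S * s2 * s3 + S1%:S * s1 ^+ 2 * s2
    + S1%:S * s2 ^+ 2 * s3 - S1%:S * s1 * s2 ^+ 2
    + s1 ^+ 2 * s3 ^+ 2 + s2 ^+ 2 * s1 * s3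
    - s2 * s1 ^+ 2 * s3.
Proof.
apply: hecke_ext => B k x y t1 t2 t3 xy k_alg [e1 e2 e3] [q1 q2 q3] br far.
rewrite !(rmorphXn, rmorphD, rmorphN, rmorphM, k_alg, e1, e2, e3) q1 q2 q3.
by move: xy; rewrite !inE => /or3P[] /eqP[-> ->];
  nc_ring [:: a; b; c] [:: t1; t2; t3].
Qed.
End HeckeIdentities.

(** * The ideal generated by b *)

Section IdealSpan.
Variables (K : fieldType) (A : kalgType K) (S1 S2 S3 : K) (s t : A).
Hypothesis S3_neq0 : S3 != 0.
Hypothesis s_cubic : s * s * s = S1%:S * (s * s) - S2%:S * s + S3%:S.
Hypothesis t_cubic : t * t * t = S1%:S * (t * t) - S2%:S * t + S3%:S.
Hypothesis st_braid : t * s * t = s * t * s.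

(** The cubic relation says u (u^2 - S1 u + S2) = S3, a nonzero scalar, so [u] can be cancelled. *)
Let cubic_unit u v : u * u * u = S1%:S * (u * u) - S2%:S * u + S3%:S ->
  v * u = 0 -> v = 0 :> A.
Proof.
move=> u3 vu; apply: (kscal_regular S3_neq0).
transitivity (v * u * (u * u) - S1%:S * (v * u * u) + S2%:S * (v * u)).
  rewrite kscalC.
  transitivity (v * (u * u * u) - v * (S1%:S * (u * u)) + v * (S2%:S * u)).
    by rewrite u3; nc_ring [:: S1; S2; S3] [:: u; v].
  by nc_ring [:: S1; S2; S3] [:: u; v].
by rewrite vu !mul0r !mulr0 subr0 addr0.
Qed.

(* The last two rules are obtained by cancelling s, resp. t, on the right of a
   consequence of the others. *)
Lemma cubic_braid_rules :
  s * s * s = S1%:S * (s * s) - S2%:S * s + S3%:S /\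
  t * t * t = S1%:S * (t * t) - S2%:S * t + S3%:S /\
  t * s * t = s * t * s /\
  t * s * s * t * s = s * t * s * s * t /\
  t * t * s * s * t = s * t * t * s * s
    + S1%:S * (t * s * s * t - s * t * t * s) + S2%:S * (s * t * t - s * s * t)
      /\
  t * s * s * t * t = s * s * t * t * s
    + S1%:S * (t * s * s * t - s * t * t * s) + S2%:S * (t * t * s - t * s * s)
      /\
  True.
Proof.
have H : s * s * s = S1%:S * (s * s) - S2%:S * s + S3%:S /\
    t * t * t = S1%:S * (t * t) - S2%:S * t + S3%:S /\
    t * s * t = s * t * s /\
    t * s * s * t * s = s * t * s * s * t /\ True.
  do 4![split=> //]; transitivity (t * s * (s * t * s));
    first by rewrite !mulrA.
  by rewrite -st_braid !mulrA st_braid.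
have [_ [_ [_ [r4 _]]]] := H.
do 4![split=> //]; split; [|split=> //]; apply/eqP; rewrite -subr_eq0;
  apply/eqP.
  by apply: (cubic_unit s_cubic); nc_ring_mod [:: S1; S2; S3] [:: s; t] H.
by apply: (cubic_unit t_cubic); nc_ring_mod [:: S1; S2; S3] [:: s; t] H.
Qed.

Let b := t ^+ 2 * s - s * t ^+ 2 - t * s ^+ 2 + s ^+ 2 * t.

Ltac nc := rewrite /b; let H := fresh in have H := cubic_braid_rules;
  nc_ring_mod [:: S1; S2; S3] [:: s; t] H.

(** This and the following identities bring products of the words in [b_words] with [s] or [t] back
    into their span. Signs are written as scalars so that closure under sums and scalar multiples
    suffices. *)
Let bst : b * s * t = (- S2)%:S * b + S1%:S * (b * s) + (-1)%:S * (b * s * s).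
Proof. nc. Qed.
Let btt : b * t * t = (- S2)%:S * b + S1%:S * (b * t) + (-1)%:S * (b * t * s).
Proof. nc. Qed.
Let bsst : b * s * s * t = S1%:S * (b * t * s) + (- S2)%:S * (b * t) + (-1)%:S
  * (b * t * s * s).
Proof. nc. Qed.
Let btst : b * t * s * t = (- S3)%:S * b.
Proof. nc. Qed.
Let btsst : b * t * s * s * t = (S2 * S2 - S1 * S3)%:S * b + (S3 - S1 * S2)%:S
  * (b * s) + S2%:S * (b * s * s).
Proof. nc. Qed.
Let tb : t * b = S1%:S * b + (-1)%:S * (b * s) + (-1)%:S * (b * t) + (-1)%:S *
  (s * b).
Proof. nc. Qed.
Let ssb : s * s * b = (- S2)%:S * b + S1%:S * (b * s) + S1%:S * (s * b) +
  (-1)%:S * (b * s * s) + (-1)%:S * (s * b * s).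
Proof. nc. Qed.
Let tsb : t * s * b = (- S1)%:S * (b * s) + b * s * s + s * b * s.
Proof. nc. Qed.
Let sbt : s * b * t = S2%:S * b + (- S1)%:S * (b * s) + b * s * s + b * t * s +
  s * b * s.
Proof. nc. Qed.
Let sbst : s * b * s * t = (- S2)%:S * (s * b) + S1%:S * (s * b * s) + (-1)%:S
  * (s * b * s * s).
Proof. nc. Qed.
Let sbsst : s * b * s * s * t = S1%:S * (s * b * t * s) + (- S2)%:S * (s * b *
  t) + (-1)%:S * (s * b * t * s * s).
Proof. nc. Qed.

(* The ideal of b is the 9-dimensional factor of the 3-dimensional irreducible
   representation; these nine words span it. *)
Definition b_words : seq A :=
  [:: b; b * s; b * t; b * s * s; b * t * s; b * t * s * s;
      s * b; s * b * s; s * b * s * s].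

Definition b_span (u : A) : Prop :=
  exists k : 'I_9 -> K, u = \sum_i (k i)%:S * b_words`_i.

Let P0 : b_span 0.
Proof. by exists (fun=> 0); rewrite big1 // => i _; rewrite kscal0 mul0r. Qed.

Let PD u v : b_span u -> b_span v -> b_span (u + v).
Proof.
case=> [k ->] [l ->]; exists (fun i => k i + l i); rewrite -big_split /=.
by apply: eq_bigr => i _; rewrite kscalD mulrDl.
Qed.

Let PZ k u : b_span u -> b_span (k%:S * u).
Proof.
case=> [l ->]; exists (fun i => k * l i); rewrite mulr_sumr.
by apply: eq_bigr => i _; rewrite kscalM mulrA.
Qed.

Let Pw (i : 'I_9) : b_span b_words`_i.
Proof.
exists (fun j => (j == i)%:R); rewrite (bigD1 i) //= big1 => [|j /negPf ->].
  by rewrite eqxx kscal1 mul1r addr0.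
by rewrite kscal0 mul0r.
Qed.

Let Pb : b_span b := Pw (@Ordinal 9 0 isT).
Let Pbs : b_span (b * s) := Pw (@Ordinal 9 1 isT).
Let Pbt : b_span (b * t) := Pw (@Ordinal 9 2 isT).
Let Pbss : b_span (b * s * s) := Pw (@Ordinal 9 3 isT).
Let Pbts : b_span (b * t * s) := Pw (@Ordinal 9 4 isT).
Let Pbtss : b_span (b * t * s * s) := Pw (@Ordinal 9 5 isT).
Let Psb : b_span (s * b) := Pw (@Ordinal 9 6 isT).
Let Psbs : b_span (s * b * s) := Pw (@Ordinal 9 7 isT).
Let Psbss : b_span (s * b * s * s) := Pw (@Ordinal 9 8 isT).
Let cube u v : u * u * u = S1%:S * (u * u) - S2%:S * u + S3%:S ->
  v * u * u * u = S1%:S * (v * u * u) + (- S2)%:S * (v * u) + S3%:S * v :> A.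
Proof.
move=> u3; transitivity (v * (u * u * u)); first by rewrite !mulrA.
by rewrite u3; nc_ring [:: S1; S2; S3] [:: u; v].
Qed.

Ltac in_words := first [exact: Pb | exact: Pbs | exact: Pbt | exact: Pbss
  | exact: Pbts | exact: Pbtss | exact: Psb | exact: Psbs | exact: Psbss].
Ltac in_span := repeat first [in_words | apply: PD | apply: PZ].

Let span_linear u (f : A -> A) : {morph f : x y / x + y} -> 
  (forall k x, f (k%:S * x) = k%:S * f x) -> (forall i : 'I_9,
    b_span (f b_words`_i)) ->
  b_span u -> b_span (f u).
Proof.
move=> fD fZ fw [k ->].
have f0 : f 0 = 0 by rewrite -[0](mul0r 0) -(kscal0 A) fZ kscal0 !mul0r.
rewrite (big_morph f fD f0); elim/big_ind: _ => // i _; rewrite fZ; exact: PZ.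
Qed.

Let span_mulrs u : b_span u -> b_span (u * s).
Proof.
apply: (span_linear (f := fun v => v * s)) => [v w|k v|];
  rewrite ?mulrDl ?mulrA //.
case=> [[|[|[|[|[|[|[|[|[|//]]]]]]]]] ?]; rewrite /b_words /=; try in_words.
- by rewrite (cube _ s_cubic); in_span.
- by rewrite (cube _ s_cubic); in_span.
- by rewrite (cube _ s_cubic); in_span.
Qed.

Let Psbt : b_span (s * b * t).
Proof. by rewrite sbt; in_span. Qed.
Let Psbts : b_span (s * b * t * s) := span_mulrs Psbt.
Let Psbtss : b_span (s * b * t * s * s) := span_mulrs Psbts.

Let span_mulrt u : b_span u -> b_span (u * t).
Proof.
apply: (span_linear (f := fun v => v * t)) => [v w|k v|];
  rewrite ?mulrDl ?mulrA //.
case=> [[|[|[|[|[|[|[|[|[|//]]]]]]]]] ?]; rewrite /b_words /=; try in_words.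
- by rewrite bst; in_span.
- by rewrite btt; in_span.
- by rewrite bsst; in_span.
- by rewrite btst; in_span.
- by rewrite btsst; in_span.
- exact: Psbt.
- by rewrite sbst; in_span.
- by rewrite sbsst; in_span; first [exact: Psbts|exact: Psbt|exact: Psbtss].
Qed.

Let span_muls u : b_span u -> b_span (s * u).
Proof.
(* Every spanning word is b or s b followed by letters, and the span is already stable under right
   multiplication; so only s b and s s b have to be examined. *)
have Pssb : b_span (s * s * b) by rewrite ssb; in_span.
apply: (span_linear (f := fun v => s * v)) => [v w|k v|];
  rewrite ?mulrDr ?kscalCA //.
case=> [[|[|[|[|[|[|[|[|[|//]]]]]]]]] ?]; rewrite /b_words /= ?mulrA;
  do ?[in_words|exact: Pssb|apply: span_mulrs|apply: span_mulrt].
Qed.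

Let span_mult u : b_span u -> b_span (t * u).
Proof.
have Ptb : b_span (t * b) by rewrite tb; in_span.
have Ptsb : b_span (t * s * b) by rewrite tsb; in_span.
apply: (span_linear (f := fun v => t * v)) => [v w|k v|];
  rewrite ?mulrDr ?kscalCA //.
case=> [[|[|[|[|[|[|[|[|[|//]]]]]]]]] ?]; rewrite /b_words /= ?mulrA;
  do ?[exact: Ptb|exact: Ptsb|apply: span_mulrs|apply: span_mulrt].
Qed.

Hypothesis generated : forall Q : A -> Prop, Q 1 ->
  (forall u v, Q u -> Q v -> Q (u + v)) -> (forall k u, Q u -> Q (k%:S * u)) ->
  (forall u, Q u -> Q (s * u)) -> (forall u, Q u -> Q (t * u)) -> forall u, Q u.

Lemma gen_ideal_b_span u : gen_ideal [set b]%classic u -> b_span u.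
Proof.
apply; split=> [|_ ->]; last exact: Pb.
have Ml x y : b_span y -> b_span (x * y).
  move: x y; apply: generated => [y|x x' Px Px' y Py|k x Px y Py|x Px y Py|x Px
    y Py].
  - by rewrite mul1r.
  - by rewrite mulrDl; apply: PD; [exact: Px|exact: Px'].
  - by rewrite -mulrA; apply/PZ/Px.
  - by rewrite -mulrA; apply/span_muls/Px.
  - by rewrite -mulrA; apply/span_mult/Px.
have Mr x y : b_span y -> b_span (y * x).
  move: x y; apply: generated => [y|x x' Px Px' y Py|k x Px y Py|x Px y Py|x Px
    y Py].
  - by rewrite mulr1.
  - by rewrite mulrDr; apply: PD; [exact: Px|exact: Px'].
  - by rewrite kscalCA; apply/PZ/Px.
  - by rewrite mulrA; apply/Px/span_mulrs.
  - by rewrite mulrA; apply/Px/span_mulrt.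
by split=> // x y z Py; apply/Mr/Ml.
Qed.
End IdealSpan.

(** Nonzero rows, one from each projection, are linearly independent, as multiplying by a projection
    isolates one of them. The matrices have size [d.+1], so the bound means size at least 3. *)
Lemma spectral_dim (K : fieldType) (lam : 'I_3 -> K) d (s : 'M[K]_d.+1) e :
  spectral lam s e -> (forall x, e x <> 0) -> (2 <= d)%N.
Proof.
move=> se en; have [e0 _ _] := se; have eid x := spectral_id x se.
have /choice[i iE] x : exists i, row i (e x) != 0.
  apply: contrapT => none; apply: (en x); apply/row_matrixP => i; rewrite row0.
  by apply/eqP/negPn/negP => ix; apply: none; exists i.
pose N : 'M_(3, d.+1) := \matrix_x row (i x) (e x).
have NE x : N *m e x = delta_mx x 0 *m row (i x) (e x).
  apply/matrixP => y j; transitivity ((e y * e x) (i y) j).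
    by rewrite -mulmxE !mxE; apply: eq_bigr => k _; rewrite !mxE.
  rewrite [RHS]mxE big_ord1 [delta_mx _ _ _ _]mxE [row _ _ _ _]mxE eqxx andbT.
  have [->|yx] := eqVneq y x; first by rewrite eid mul1r.
  by rewrite e0 // mxE mul0r.
suff : row_free N by rewrite -row_leq_rank => /leq_trans/(_ (rank_leq_col N)).
apply: inj_row_free => v vN; apply/rowP => x.
have : v *m N *m e x = 0 by rewrite vN mul0mx.
rewrite -mulmxA NE mulmxA => /rowP vx; apply/eqP; rewrite mxE.
have /rV0Pn[j jx] := iE x; move: (vx j).
rewrite mxE big_ord1 [RHS]mxE => /eqP; rewrite mulf_eq0 (negPf jx) orbF => /eqP.
rewrite mxE (bigD1 x) //= big1 => [|y yx];
  first by rewrite !mxE !eqxx mulr1 addr0 => ->.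
by rewrite mxE (negPf yx) mulr0.
Qed.

(** * The unique factor on which b does not vanish *)

Section AttachedIdeal.
Variables (K : fieldType) (A : kalgType K) (r : nat) (d : 'I_r -> nat).
Variable f : forall i, {rmorphism A -> 'M[K]_((d i).+1)}.
Hypothesis f_alg : forall i, alg_morphism (f i).
Hypothesis f_bij : forall y : forall i, 'M[K]_((d i).+1),
  exists! x : A, forall i, f i x = y i.
Variables (b : A) (w : seq A).
Hypothesis b_dim : forall i, f i b <> 0 -> (2 <= d i)%N.
Local Notation I := (gen_ideal [set b]%classic).
Hypothesis b_spanned : forall u, I u ->
  exists k : 'I_9 -> K, u = \sum_i (k i)%:S * w`_i.

Lemma component_gen_ideal i : f i b = 0 -> forall u, I u -> f i u = 0.
Proof. by move=> fb; apply: gen_ideal_ker => _ ->. Qed.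

Lemma gen_ideal_component i j : f i b <> 0 -> f j b <> 0 -> i = j.
Proof.
move=> fi fj; apply/eqP/contraT => ij.
have Ib : I b by exact: gen_ideal_sub.
have [ui Iui [ui1 ui0]] := ideal_component f_bij Ib fi.
have [uj Iuj [uj1 uj0]] := ideal_component f_bij Ib fj.
have [_ ID IM] := idealP I.
(* [phi] flattens both factors into one row and is onto already on the ideal of b. The nine images
   of the spanning words, the rows of [N], would then span a space of dimension at least 9 + 9. *)
pose phi (u : A) := row_mx (mxvec (f i u)) (mxvec (f j u)).
have phiD : {morph phi : u v / u + v}.
  by move=> u v; rewrite /phi !rmorphD !linearD /= add_row_mx.
have phiZ k u : phi (k%:S * u) = k *: phi u.
  by rewrite /phi !rmorphM !f_alg -!mulmxE !mul_scalar_mx !linearZ /=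
    scale_row_mx.
pose N := \matrix_(k < 9) phi w`_k.
have : (N :=: 1%:M)%MS.
  apply/eqmxP; rewrite submx1 /=; apply/row_subP => k; move: (row k _) => v {k}.
  have [x xi xi0] := component_lift f_bij (vec_mx (lsubmx v)).
  have [y yj yj0] := component_lift f_bij (vec_mx (rsubmx v)).
  have vE : v = phi (x * ui + y * uj).
    rewrite /phi !rmorphD !rmorphM xi ui1 (yj0 i) // uj1 yj (xi0 j) 1?eq_sym //.
    by rewrite !mul0r add0r addr0 !mulr1 !vec_mxK hsubmxK.
  have [k kE] : exists k : 'I_9 -> K, x * ui + y * uj = \sum_l (k l)%:S * w`_l.
    apply: b_spanned; apply: ID; rewrite -[_ * _]mulr1; exact: IM.
  apply/submxP; exists (\row_l k l); rewrite vE kE.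
  have phi0 : phi 0 = 0 by rewrite /phi !rmorph0 !linear0 row_mx0.
  rewrite (big_morph phi phiD phi0) mulmx_sum_row; apply: eq_bigr => l _.
  by rewrite phiZ rowK mxE.
move=> N1; have := rank_leq_row N; rewrite N1 mxrank1.
have := b_dim fi; have := b_dim fj; set di := d i; set dj := d j => hj hi.
have : (9 + 9 <= di.+1 * di.+1 + dj.+1 * dj.+1)%N.
  by rewrite leq_add // (@leq_mul 3 3).
by move=> h /(leq_trans h).
Qed.

Variable V : {rmorphism A -> 'M[K]_3}.
Hypothesis Vb : V b <> 0.

(** The ideal is exactly the factor [i0] on which b survives. Every nonzero ideal inside it contains
    the central idempotent [u] of that factor, which gives indecomposability, and the kernel of
    [f i0] is a complement. *)
Lemma attached_gen_ideal : attached_ideal I V.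
Proof.
have Ib : I b by exact: gen_ideal_sub.
have [i0 fb] : exists i, f i b <> 0.
  apply: contrapT => none; apply: Vb; rewrite -(rmorph0 V); congr (V _).
  apply: (component_inj f_bij) => i; rewrite rmorph0; apply: contrapT => fb.
  by apply: none; exists i.
have fI i u : i != i0 -> I u -> f i u = 0.
  move=> ii0; apply: component_gen_ideal; apply: contrapT => fi.
  by move/eqP: ii0; apply; exact: gen_ideal_component.
have [u Iu [u1 u0]] := ideal_component f_bij Ib fb.
have [_ ID IM] := idealP I.
have memu (J : ideal A) : (forall y, J y -> I y) -> ~ zero_set J -> J u.
  move=> JI Jn; have [y Jy y0] : exists2 y, J y & y <> 0.
    by apply: contrapT => none; apply: Jn => y Jy; apply: contrapT => y0;
      apply: none; exists y.
  have fy : f i0 y <> 0.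
    move=> fy; apply: y0; apply: (component_inj f_bij) => i; rewrite rmorph0.
    by have [->//|ii0] := eqVneq i i0; rewrite fI //; exact: JI.
  have [v Jv [v1 v0]] := ideal_component f_bij Jy fy.
  suff -> : u = v by [].
  apply: (component_inj f_bij) => i.
  by have [->|ii0] := eqVneq i i0; rewrite ?u1 ?v1 // u0 ?v0.
split; last by exists b.
- split=> [I0|J J' [IJ JJ']]; first by apply: Vb; rewrite (I0 b Ib) rmorph0.
  apply: contrapT => /not_orP[Jn Jn'].
  have Ju : J u.
    apply: memu => // y Jy; apply/IJ; exists y, 0; rewrite addr0; split=> //.
    by case: (idealP J').
  have J'u : J' u.
    apply: memu => // y Jy; apply/IJ; exists 0, y; rewrite add0r; split=> //.
    by case: (idealP J).
  have := u1; rewrite (JJ' u (conj Ju J'u)) rmorph0 => /eqP.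
  by rewrite eq_sym oner_eq0.
have kerP : two_sided [set x | f i0 x = 0]%classic.
  split=> [|x y|x y z]; rewrite /mkset ?rmorph0 //.
    by rewrite rmorphD => -> ->; rewrite addr0.
  by rewrite !rmorphM => ->; rewrite mulr0 mul0r.
exists (Ideal kerP); split=> [x|x [Ix fx]].
  split=> // _; exists (x * u), (x - x * u); split.
  - by rewrite -[x * u]mulr1; exact: IM.
  - by rewrite /= /mkset rmorphB rmorphM u1 mulr1 subrr.
  - by rewrite addrC subrK.
apply: (component_inj f_bij) => i; rewrite rmorph0.
by have [->|ii0] := eqVneq i i0; [exact: fx|exact: fI].
Qed.
End AttachedIdeal.

(** * Irreducible representations of split semisimple algebras *)

Section IrreducibleRepresentation.
Variables (K : fieldType) (A : kalgType K) (m : nat).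
Variable V : {rmorphism A -> 'M[K]_m.+1}.
Hypothesis V_irr : irreducible_rep V.

(** The central idempotents u_i add up to 1, so some V(u_i) is nonzero. Its row space is stable,
    hence everything, and an invertible idempotent is 1; so [V] factors through [f i]. An ideal not
    killed by [f i] contains u_i and is not killed by [V] either. *)
Lemma irreducible_factor (r : nat) (d : 'I_r -> nat)
    (f : forall i, {rmorphism A -> 'M[K]_((d i).+1)}) :
  (forall y : forall i, 'M[K]_((d i).+1), exists! x : A, forall i,
    f i x = y i) ->
  exists i, (forall x, f i x = 0 -> V x = 0) /\
    forall J : ideal A, (forall y, J y -> V y = 0) -> forall y,
      J y -> f i y = 0.
Proof.
move=> f_bij; have [_ V_alg V_simple] := V_irr.
have /choice[u uE] i : exists u, f i u = 1 /\ forall j, j != i -> f j u = 0.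
  by have [u u1 u0] := component_lift f_bij (1 : 'M[K]_((d i).+1)); exists u.
have u_eq i x y : f i x = f i y -> x * u i = y * u i.
  move=> xy; apply: (component_inj f_bij) => j; rewrite !rmorphM.
  by have [->|ji] := eqVneq j i; [rewrite xy|rewrite (proj2 (uE i)) ?mulr0].
have u_comm i x : x * u i = u i * x.
  apply: (component_inj f_bij) => j; rewrite !rmorphM.
  have [->|ji] := eqVneq j i; first by rewrite (proj1 (uE i)) mulr1 mul1r.
  by rewrite (proj2 (uE i)) ?mulr0 ?mul0r.
have u_id i : u i * u i = u i by rewrite (u_eq i _ 1) ?mul1r ?(proj1 (uE i))
  ?rmorph1.
have sum_u : \sum_i u i = 1.
  apply: (component_inj f_bij) => j; rewrite rmorph_sum rmorph1 (bigD1 j) //=.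
  rewrite (proj1 (uE j)) big1 ?addr0 // => i ij.
  by rewrite (proj2 (uE i)) // eq_sym.
have [i Vu] : exists i, V (u i) = 1.
  have [i Vi] : exists i, V (u i) <> 0.
    apply: contrapT => none; have : V 1 = 0.
      rewrite -sum_u rmorph_sum big1 // => i _; apply: contrapT => Vi.
      by apply: none; exists i.
    by move/eqP; rewrite rmorph1 oner_eq0.
  have [|//|full] := V_simple (V (u i)).
    move=> x; rewrite -[V (u i) *m V x]/(V (u i) * V x).
    by rewrite -rmorphM -u_comm rmorphM; exact: submxMl.
  exists i; move: full; rewrite row_full_unit => unitV.
  by apply: (mulrI unitV); rewrite -rmorphM u_id mulr1.
exists i; split=> [x fx|J JV y Jy].
  by rewrite -[V x]mulr1 -Vu -rmorphM (u_eq i x 0) ?rmorph0 // mul0r rmorph0.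
apply: contrapT => fy; have [v Jv [v1 v0]] := ideal_component f_bij Jy fy.
have uv : u i = v.
  apply: (component_inj f_bij) => j.
  by have [->|ji] := eqVneq j i; rewrite ?(proj1 (uE i)) ?v1 // v0 // (proj2
    (uE i)).
by have /eqP := JV v Jv; rewrite -uv Vu oner_eq0.
Qed.

Lemma irreducible_no_line (v : 'rV[K]_m.+1) : (0 < m)%N -> v != 0 ->
  (forall x, exists k, v *m V x = k *: v) -> False.
Proof.
move=> m0 v0 vV; have [_ _ V_simple] := V_irr.
(* All rows of this square matrix equal [v], so its row space is the line of [v]. *)
pose U : 'M[K]_m.+1 := const_mx 1 *m v.
have [|U0|] := V_simple U.
- move=> x; have [k vk] := vV x.
  by rewrite -mulmxA vk -scalemxAr scalemx_sub.
- case/eqP: v0; apply/rowP => j; have /matrixP/(_ 0 j) := U0.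
  by rewrite !mxE big_ord1 mxE mul1r.
move=> /eqP full; have : (\rank U <= 1)%N.
  exact: leq_trans (mxrankM_maxr _ _) (rank_leq_row v).
by rewrite full ltnS leqNgt m0.
Qed.
End IrreducibleRepresentation.

(** Two 3 by 3 matrices with product zero have ranks adding up to at most 3, so one of the factors
    has rank at most 1. By conjugation the same eigenvalue serves [t], and two planes in a space of
    dimension 3 meet in a line at least. *)
Lemma conj_common_eigenvector (K : fieldType) (s t g h : 'M[K]_3) (x y : K) :
  g * h = 1 -> t * g = g * s -> (s - x%:S) * (s - y%:S) = 0 ->
  exists k (v : 'rV[K]_3), [/\ v != 0, v *m s = k *: v & v *m t = k *: v].
Proof.
move=> gh tg sxy.
have [z rz] : exists z : K, (\rank (s - z%:S)%R <= 1)%N.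
  have := mulmx0_rank_max sxy.
  case: (leqP (\rank (s - x%:S)%R) 1) => [?|rx]; first by exists x.
  case: (leqP (\rank (s - y%:S)%R) 1) => [?|ry]; first by exists y.
  by move=> /(leq_trans (leq_add rx ry)).
have rt : (\rank (t - z%:S)%R <= 1)%N.
  have -> : t - z%:S = g * ((s - z%:S) * h).
    by rewrite -(intertwine_scal z h tg) gh mulr1.
  exact: leq_trans (mxrankM_maxr _ _) (leq_trans (mxrankM_maxl _ _) rz).
pose M := row_mx (s - z%:S) (t - z%:S).
have /rowV0Pn[v /sub_kermxP vM v0] : kermx M != 0.
  rewrite -mxrank_eq0 mxrank_ker subn_eq0 -ltnNge ltnS.
  have rM : (\rank M <= \rank (s - z%:S)%R + \rank (t - z%:S)%R)%N.
    rewrite -mxrank_tr tr_row_mx -addsmxE.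
    have [] := mxrank_adds_leqif (s - z%:S)^T (t - z%:S)^T.
    by rewrite [\rank (s - _)^T]mxrank_tr [\rank (t - _)^T]mxrank_tr.
  exact: leq_trans rM (leq_add rz rt).
have kill (w : 'M[K]_3) : v *m (w - z%:S) = 0 -> v *m w = z *: v.
  by rewrite mulmxBr mul_mx_scalar => /subr0_eq.
move: vM; rewrite mul_mx_row -[0]row_mx0 => /eq_row_mx[/kill vs /kill vt].
by exists z, v.
Qed.

Section CubicHecke3.
Variables (K : fieldType) (a b c : K).
Hypothesis abc : (a - b) * (a - c) * (b - c) != 0.
Hypothesis abc0 : [/\ a != 0, b != 0 & c != 0].
Local Notation H := (Hn 3 a b c).
Local Notation p := (quo_proj (cubic_ideal 3 a b c)).
Local Notation s := (sH 3 a b c 1).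
Local Notation t := (sH 3 a b c 2).

Let sV i : H := p (sBV K 3 i).
Let sK : forall i, sH 3 a b c i * sV i = 1 := image_sBK p.
Let s_braid : forall i, (0 < i)%N -> (i.+1 < 3)%N ->
  sH 3 a b c i * sH 3 a b c i.+1 * sH 3 a b c i
    = sH 3 a b c i.+1 * sH 3 a b c i * sH 3 a b c i.+1 := image_sB_braid p.

Lemma H3_ind (Q : H -> Prop) : Q 1 ->
  (forall u v, Q u -> Q v -> Q (u + v)) -> (forall k u, Q u -> Q (k%:S * u)) ->
  (forall u, Q u -> Q (s * u)) -> (forall u, Q u -> Q (t * u)) -> forall u, Q u.
Proof.
move=> Q1 QD QZ Qs Qt.
have p_ind := fun P => @image_ind K 3 H p (@quo_proj_alg _ _ _) P
  (@quo_proj_surj _ _ _).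
apply: (positive_ind sK s_braid abc0 (Hn_cubic 3 a b c) p_ind) => //.
by case=> [|[|[|i]]] u // _; [exact: Qs|exact: Qt].
Qed.

Lemma H3_cubic i : (0 < i < 3)%N ->
  (sH 3 a b c i - a%:S) * (sH 3 a b c i - b%:S) * (sH 3 a b c i - c%:S) = 0.
Proof. move=> hi; exact (braid_vanish3 sK s_braid hi (Hn_cubic 3 a b c)). Qed.

(** If an eigenprojection of s_1 vanished in the factor, s_1 and its conjugate s_2 would satisfy the
    same quadratic relation and b would be zero there. *)
Lemma bH_component_dim d (f : {rmorphism H -> 'M[K]_d.+1}) :
  alg_morphism f -> f (bH 3 a b c) <> 0 -> (2 <= d)%N.
Proof.
move=> f_alg fb.
have fs : (f s - a%:S) * (f s - b%:S) * (f s - c%:S) = 0.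
  by rewrite -alg_morphism_cubic // Hn_cubic rmorph0.
have [e se] := cubic_spectral abc fs.
apply: (spectral_dim se) => x ex; apply: fb.
have [y [z xyz]] : exists y z, uniq [:: x; y; z].
  by exists (x + 1), (x + 1 + 1); case: x {ex} => [[|[|[|//]]] ?].
have s0 := missing_eigenvalue_quadratic se xyz ex.
have [g [h [gh tg]]] := braid_conj sK s_braid (isT : 0 < 2 < 3)%N.
have t0 : (f t - (lam3 a b c y)%:S) * (f t - (lam3 a b c z)%:S) = 0.
  apply: (@intertwine_vanish2 _ _ (f g) (f h) _ (f t) (f s)) s0.
    by rewrite -rmorphM gh rmorph1.
  by rewrite -!rmorphM tg.
by apply: etrans (rmorph_b f s t) (quadratic_b s0 t0).
Qed.

Lemma bH_spanned : exists w : seq H, forall u : H,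
  gen_ideal [set bH 3 a b c]%classic u ->
  exists k : 'I_9 -> K, u = \sum_i (k i)%:S * w`_i.
Proof.
have cub i : (0 < i < 3)%N ->
  sH 3 a b c i * sH 3 a b c i * sH 3 a b c i
  = (a + b + c)%:S * (sH 3 a b c i * sH 3 a b c i)
    - (a * b + b * c + a * c)%:S * sH 3 a b c i + (a * b * c)%:S.
  move=> /H3_cubic; move: (sH 3 a b c i) => x x0.
  apply/eqP; rewrite -subr_eq0 -x0; apply/eqP.
  by nc_ring [:: a; b; c] [:: x].
have abc_neq0 : a * b * c != 0 by case: abc0 => *; rewrite !mulf_neq0.
exists (b_words s t) => u.
exact (gen_ideal_b_span abc_neq0 (cub 1 isT) (cub 2 isT) (esym (@s_braid 1 isT
  isT)) H3_ind (u := u)).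
Qed.

Lemma irreducible_bH_neq0 (V : {rmorphism H -> 'M[K]_3}) :
  split_semisimple H -> irreducible_rep V -> V (bH 3 a b c) <> 0.
Proof.
move=> [r [d [f [f_alg f_bij]]]] V_irr Vb; have [_ V_alg _] := V_irr.
have [i [Vf fV]] := irreducible_factor V_irr f_bij.
(* If [V] kills b, so does the factor through which it passes; that factor is then quadratic, and
   the relation descends to [V]. *)
have fb : f i (bH 3 a b c) = 0.
  apply: (fV (gen_ideal [set bH 3 a b c]%classic)); last exact: gen_ideal_sub.
  by apply: gen_ideal_ker => _ ->.
have f_surj m : exists u, m = f i u.
  by have [u <- _] := component_lift f_bij m; exists u.
have [x [y [_ fs]]] := prime_factor_quadratic abc abc0 (isT : 1 < 3 <= 4)%N
  (f_alg i) f_surj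
  (@matrix_prime K _) (fun _ => fb).
have Vs : (V s - x%:S) * (V s - y%:S) = 0.
  by rewrite -alg_morphism_quadratic //; apply: Vf;
    rewrite alg_morphism_quadratic.
have [g [h [gh tg]]] := braid_conj sK s_braid (isT : 0 < 2 < 3)%N.
have [||k [v [v0 vs vt]]] := @conj_common_eigenvector K (V s) (V t) (V g) (V h)
  x y _ _ Vs.
- by rewrite -rmorphM gh rmorph1.
- by rewrite -!rmorphM tg.
apply: (irreducible_no_line V_irr isT v0) => u.
elim/H3_ind: u => [|u u' [l lu] [l' lu']|l u [l' lu]|u [l lu]|u [l lu]].
- by exists 1; rewrite rmorph1 mulmx1 scale1r.
- by exists (l + l'); rewrite rmorphD mulmxDr lu lu' scalerDl.
- by exists (l * l'); rewrite rmorphM V_alg -mulmxE mul_scalar_mx -scalemxAr lu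
  scalerA.
- by exists (k * l); rewrite rmorphM -mulmxE mulmxA vs -scalemxAl lu scalerA.
- by exists (k * l); rewrite rmorphM -mulmxE mulmxA vt -scalemxAl lu scalerA.
Qed.

Lemma attached_bH (V : {rmorphism H -> 'M[K]_3}) :
  split_semisimple H -> irreducible_rep V ->
  attached_ideal (gen_ideal [set bH 3 a b c]%classic) V.
Proof.
move=> ss V_irr; have Vb := irreducible_bH_neq0 ss V_irr.
have [w wP] := bH_spanned; have [r [d [f [f_alg f_bij]]]] := ss.
exact: (attached_gen_ideal f_alg f_bij (fun i =>
  bH_component_dim (f_alg i)) wP Vb).
Qed.
End CubicHecke3.

(** * Relations in K_3 and K_4 *)

Section CalKRelations.
Variables (K : fieldType) (a b c : K) (n : nat).

Lemma calK_braid : (2 < n)%N ->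
  sK n a b c 1 * sK n a b c 2 * sK n a b c 1
    = sK n a b c 2 * sK n a b c 1 * sK n a b c 2.
Proof. exact: (image_sB_braid (to_calK n a b c) (isT : 0 < 1)%N). Qed.

Lemma calK_far : (3 < n)%N ->
  sK n a b c 1 * sK n a b c 3 = sK n a b c 3 * sK n a b c 1.
Proof.
exact: (image_sB_far (to_calK n a b c) (isT : 0 < 1)%N (isT : 1.+1 < 3)%N).
Qed.

Hypothesis abc : (a - b) * (a - c) * (b - c) != 0.
Hypothesis abc0 : [/\ a != 0, b != 0 & c != 0].
Hypothesis n34 : (2 < n <= 4)%N.
Hypothesis n_ss : split_semisimple (Hn n a b c).

Lemma calK_cubic i : (0 < i < n)%N ->
  (sK n a b c i - a%:S) * (sK n a b c i - b%:S) * (sK n a b c i - c%:S) = 0.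
Proof.
move=> hi; apply: (calK_ext abc abc0 _ (or_intror n_ss)); first by lia.
move=> B k x y xy k_alg kS; rewrite alg_morphism_cubic // rmorph0.
exact: quadratic_cubic xy (kS i hi).
Qed.

Lemma calK_ext3 i j (u v : calK n a b c) : (0 < i < n)%N -> (0 < j < n)%N ->
  forall l, (0 < l < n)%N ->
  (forall (B : kalgType K) (k : {rmorphism calK n a b c -> B}) x y,
    (x, y) \in [:: (a, b); (a, c); (b, c)] -> alg_morphism k ->
    [/\ (k (sK n a b c i) - x%:S) * (k (sK n a b c i) - y%:S) = 0,
        (k (sK n a b c j) - x%:S) * (k (sK n a b c j) - y%:S) = 0
      & (k (sK n a b c l) - x%:S) * (k (sK n a b c l) - y%:S) = 0] ->
    k u = k v) -> u = v.
Proof.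
move=> hi hj l hl kuv; apply: (calK_ext abc abc0 _ (or_intror n_ss));
  first by lia.
by move=> B k x y xy k_alg kS; apply: kuv xy k_alg _; split; exact: kS.
Qed.

End CalKRelations.

Theorem proposition2p10 (K : fieldType) (a b c : K) :
  [pchar K] =i pred0 ->
  generic a b c ->
  let Sigma1 := a + b + c in
  let Sigma2 := a * b + b * c + a * c in
  let Sigma3 := a * b * c in
  [/\ forall V : {rmorphism Hn 3 a b c -> 'M[K]_3}, irreducible_rep V ->
        attached_ideal (gen_ideal [set bH 3 a b c]%classic) V,
      forall n : nat, (2 <= n <= 4)%N ->
        exists f : {rmorphism calK n a b c -> calH n a b c},
          [/\ alg_morphism f,
              forall i : nat, (0 < i < n)%N -> f (sK n a b c i) = sHH n a b c i
            & bijective f],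
      let s1 := sK 3 a b c 1 in let s2 := sK 3 a b c 2 in
      [/\ (s1 - a%:S) * (s1 - b%:S) * (s1 - c%:S) = 0
          /\ (s2 - a%:S) * (s2 - b%:S) * (s2 - c%:S) = 0,
          s2 ^+ 2 * s1
            = s2 * s1 ^+ 2 - s1 ^+ 2 * s2 + s1 * s2 ^+ 2
        & s2 * s1 ^+ 2 * s2
            = - Sigma3%:S * s1 + Sigma2%:S * s1 * s2 + s1 * s2 * s1 ^+ 2
              - Sigma1%:S * s1 * s2 ^+ 2 + s1 ^+ 2 * s2 ^+ 2]
    & let s1 := sK 4 a b c 1 in let s2 := sK 4 a b c 2 in
      let s3 := sK 4 a b c 3 in
      [/\ s2 * s3 ^+ 2
            = - s1 ^+ 2 * s3 + s1 ^+ 2 * s2 + s2 ^+ 2 * s3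
              - s1 * s2 ^+ 2 + s1 * s3 ^+ 2,
          s2 ^+ 2 * s3 * s1
            = s2 * s1 ^+ 2 * s3 - s1 ^+ 2 * s2 * s3
              + s1 * s2 ^+ 2 * s3,
          s2 ^+ 2 * s3 ^+ 2
            = - Sigma3%:S * s1 + Sigma2%:S * s1 * s3 - Sigma1%:S * s1 ^+ 2 * s3
              + Sigma3%:S * s2 - Sigma2%:S * s2 * s3 + Sigma1%:S * s1 ^+ 2 * s2
              - s1 ^+ 2 * s2 * s3 + Sigma1%:S * s2 ^+ 2 * s3
              - Sigma1%:S * s1 * s2 ^+ 2 + s1 * s2 ^+ 2 * s3
              + s1 ^+ 2 * s3 ^+ 2
        & s2 ^+ 2 * s3 ^+ 2
            = - Sigma3%:S * s1 + Sigma2%:S * s1 * s3 - Sigma1%:S * s1 ^+ 2 * s3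
              + Sigma3%:S * s2 - Sigma2%:S * s2 * s3 + Sigma1%:S * s1 ^+ 2 * s2
              + Sigma1%:S * s2 ^+ 2 * s3 - Sigma1%:S * s1 * s2 ^+ 2
              + s1 ^+ 2 * s3 ^+ 2 + s2 ^+ 2 * s1 * s3
              - s2 * s1 ^+ 2 * s3]].
Proof.
move=> _ [abc0 abc ss3 ss4] Sigma1 Sigma2 Sigma3; split.
- by move=> V; exact: attached_bH.
- case=> [|[|[|[|[|n]]]]] // _; apply: calK_iso => //;
  [by left|by right|by right].
- have br := calK_braid a b c (isT : 2 < 3)%N.
  (* For n = 3 the generator s_1 also plays the part of the third one, which makes the commutation
     hypothesis an instance of reflexivity. *)
  have ext u v := @calK_ext3 K a b c 3 abc abc0 isT ss3 1 2 u v isT isT 1 isT.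
  move=> s1 s2; split.
  + by split; exact: (calK_cubic abc abc0 (isT : 2 < 3 <= 4)%N ss3).
  + exact: (calK_rel_ii ext br erefl).
  + exact: (calK_rel_iii ext br erefl).
have br := calK_braid a b c (isT : 2 < 4)%N.
have far := calK_far a b c (isT : 3 < 4)%N.
have ext u v := @calK_ext3 K a b c 4 abc abc0 isT ss4 1 2 u v isT isT 3 isT.
move=> s1 s2 s3; split.
- exact: (calK_rel_iv ext br far).
- exact: (calK_rel_v ext br far).
- exact: (calK_rel_vi ext br far).
- exact: (calK_rel_vii ext br far).
Qed.
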